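(* Let $X_1,X_2,\ldots,X_1',X_2',\ldots$ be independent exponential random variables with mean $1$. Then, as $n\to\infty$, $$(n+1)(1-T_n)\ \xrightarrow{d}\ \max\Big\{\sum_{j=1}^{\infty}\frac{1}{2^j-1}X_j,\ \sum_{j=1}^{\infty}\frac{1}{2^j-1}X_j'\Big\},$$ and the limiting distribution is, for $t\ge 0$, $$\lim_{n\to\infty}\mathbb{P}\big(T_n>1-t/(n+1)\big)=[P(t)]^2,$$ where $$P(t)=1-\sum_{j=1}^{\infty}(-1)^{j-1}2^j\exp\{-(2^j-1)t\}\prod_{l=1}^{j}\frac{1}{2^l-1}.$$
   Context: For each $n\ge1$, let $U_1,\dots,U_n$ be independent random variables uniformly distributed on $[0,1)$, with order statistics $0=U_{0:n}<U_{1:n}<\cdots<U_{n:n}<U_{n+1:n}=1$ and spacings $D_{i,n}=U_{i:n}-U_{i-1:n}$, $1\le i\le n+1$. $T_n$ is the minimal travel time of a picker who starts at point $0$ of a circle of length $1$ (identified with $[0,1)$) and must collect $n$ items located at $U_1,\dots,U_n$, moving along the circle at unit speed in either direction (not required to return to $0$). It is given by $$T_n=1-\max\Big\{\max_{1\le j\le n}\{D_{j,n}-U_{j-1:n}\},\ \max_{1\le j\le n}\{D_{n+2-j,n}-(1-U_{n+2-j:n})\}\Big\}.$$ $\xrightarrow{d}$ denotes convergence in distribution. *)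

(* Defs.v *)
From HB Require Import structures.
From mathcomp Require Import all_boot all_order all_algebra finmap.
From mathcomp Require Import all_classical all_reals all_analysis.
From mathcomp Require Import measurable_realfun.

Set Implicit Arguments.
Unset Strict Implicit.
Unset Printing Implicit Defensive.

Import Order.TTheory GRing.Theory Num.Theory.
Import numFieldNormedType.Exports.

Local Open Scope classical_set_scope.
Local Open Scope ring_scope.

Section random_variables.
Context {R : realType}.

Definition has_law d (T : measurableType d) (P : probability T R)
    (X : {RV P >-> R}) (mu : set R -> \bar R) : Prop :=
  forall A : set R, measurable A -> distribution P X A = mu A.

Definition mutually_independent d (T : measurableType d) (P : probability T R)
    (I : choiceType) (X : I -> {RV P >-> R}) : Prop :=
  forall (J : {fset I}) (A : I -> set R),
    (forall i, measurable (A i)) ->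
    P (\bigcap_(i in [set` J]) (X i @^-1` A i)) =
    (\prod_(i <- J) P (X i @^-1` A i))%E.

(* The variables may live on different probability spaces. *)
Definition cvg_in_distribution (d : nat -> measure_display)
    (T : forall n, measurableType (d n)) (P : forall n, probability (T n) R)
    (Y : forall n, {RV (P n) >-> R})
    d' (T' : measurableType d') (Q : probability T' R) (Z : {RV Q >-> R}) :
    Prop :=
  forall t : R, {for t, continuous (cdf Z)} ->
    cdf (Y n) t @[n --> \oo] --> cdf Z t.

End random_variables.

Section travel_time.
Context {R : realType} (n : nat).
Implicit Type u : 'I_n -> R.

(* 0 = u_(0:n), u_(1:n) <= ... <= u_(n:n), u_(n+1:n) = 1 *)
Definition order_stat u (i : nat) : R :=
  nth 0 (0 :: rcons (sort <=%R [seq u k | k <- enum 'I_n]) 1) i.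

Definition spacing u (i : nat) : R := order_stat u i - order_stat u i.-1.

(* Minimal time for a picker starting at 0 on the circle of length 1, moving at
   unit speed in either direction, to visit all the points u k: the gap of
   index j is left unvisited, at the cost of retracing the shorter side.
   The maxima are over the nonempty range 1 <= j <= n, for n >= 1; each big
   operator is initialised with its own term of index j = 1, which therefore
   does not change its value. *)
Definition travel_time u : R :=
  let a j := spacing u j - order_stat u j.-1 in
  let b j := spacing u (n + 2 - j)%N - (1 - order_stat u (n + 2 - j)%N) in
  1 - Num.max (\big[Num.max/a 1%N]_(1 <= j < n.+1) a j)
              (\big[Num.max/b 1%N]_(1 <= j < n.+1) b j).

End travel_time.

Section measurability.
Context d (T : measurableType d) (R : realType).

Lemma measurable_order_stat n (U : 'I_n -> T -> R) i :
  (forall k, measurable_fun setT (U k)) ->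
  measurable_fun setT (fun w => order_stat (U ^~ w) i).
Proof.
move=> mU; rewrite /order_stat; case: i => [|i] /=; first exact: measurable_cst.
under eq_fun do rewrite nth_rcons size_sort size_map size_enum_ord.
case: ltnP => [ltin|_]; last by case: eqP => _; exact: measurable_cst.
apply: (measurability _ (RGenOInfty.measurableE R)) => // _ [_ [x ->] <-].
rewrite setTI.
pose c w : R := \sum_(k < n) \1_(U k @^-1` `]-oo, x]) w.
have mc : measurable_fun setT c.
  apply: measurable_sum => k; apply: measurable_indic.
  by rewrite -[X in measurable X]setTI; apply: mU.
have cE w : c w = (count (<= x) (sort <=%R [seq U k w | k <- enum 'I_n]))%:R.
  rewrite count_sort count_map -sum1_count natr_sum big_enum_cond/=.
  rewrite [RHS]big_mkcond /=; apply: eq_bigr => k _.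
  rewrite indicE; case: ifPn => ux; first by rewrite mem_set//= in_itv.
  by rewrite memNset//= in_itv/=; exact/negP.
rewrite (_ : _ @^-1` _ = c @^-1` `]-oo, i%:R]); last first.
  apply/seteqP; split => w; rewrite /= !in_itv/= ?andbT cE ler_nat.
    apply: contraTT; rewrite -ltnNge -leNgt => ?.
    by apply: nth_count_le => //; exact: sort_le_sorted.
  move=> ?; apply: nth_count_gt; first exact: sort_le_sorted.
  by apply/andP; split => //; rewrite size_sort size_map size_enum_ord.
by rewrite -[X in measurable X]setTI; exact: mc.
Qed.

Lemma measurable_bigmax (F : nat -> T -> R) (f : T -> R) m n :
  measurable_fun setT f -> (forall j, measurable_fun setT (F j)) ->
  measurable_fun setT (fun w => \big[Num.max/f w]_(m <= j < n) F j w).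
Proof.
move=> mf mF; rewrite unlock /reducebig.
elim: (index_iota m n) => //= j s ih; exact: measurable_maxr.
Qed.

Lemma measurable_travel_time n (U : 'I_n -> T -> R) :
  (forall k, measurable_fun setT (U k)) ->
  measurable_fun setT (fun w => travel_time (U ^~ w)).
Proof.
move=> mU; have mo i := measurable_order_stat i mU.
have ms i : measurable_fun setT (fun w => spacing (U ^~ w) i).
  exact: measurable_funB.
apply: measurable_funB => //; apply: measurable_maxr; apply: measurable_bigmax => *;
  by do ?apply: measurable_funB.
Qed.

Lemma measurable_limn (F : nat -> T -> R) :
  (forall n, measurable_fun setT (F n)) ->
  measurable_fun setT (fun w => limn (F ^~ w)).
Proof.
move=> mF.
pose E n w := (F n w)%:E.
have mE n : measurable_fun setT (E n) by apply/measurable_EFinP.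
pose S w := limn_esup (E ^~ w); pose I w := limn_einf (E ^~ w).
have mS : measurable_fun setT S by exact: measurable_fun_limn_esup.
have mI : measurable_fun setT I.
  apply: measurableT_comp => //; apply: measurable_fun_limn_esup => n.
  exact: measurableT_comp.
pose b w := (S w \is a fin_num) && ~~ (S w != I w).
have mb : measurable_fun setT b.
  apply: measurable_and; last apply: measurable_neg;
    apply: (measurable_fun_bool true).
  - exact: emeasurable_fin_num.
  - exact: measurable_neqe.
have bP w : reflect (cvgn (F ^~ w)) (b w).
  apply: (iffP andP) => [[Sfin /negPn/eqP SI]|cF].
    suff : E ^~ w @ \oo --> (fine (S w))%:E by move=> /fine_cvg/cvgP.
    rewrite fineK//; apply: (@squeeze_cvge _ _ _ _ (einfs (E ^~ w)) _ (esups (E ^~ w))).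
    + by apply: nearW => n; apply/andP; split; [apply: ereal_inf_lbound|apply: ereal_sup_ubound]; exists n => /=.
    + by rewrite SI /I limn_einf_lim; exact: is_cvg_einfs.
    + by rewrite /S limn_esup_lim; exact: is_cvg_esups.
  have cE : E ^~ w @ \oo --> (limn (F ^~ w))%:E
    by apply: cvg_EFin; [exact: nearW|exact: cF].
  by have [iE sE] := cvg_limn_einf_sup cE; rewrite /S /I iE sE eqxx.
rewrite (_ : (fun w => _) = fun w => if b w then fine (S w) else point).
  apply: measurable_fun_if => //.
  by apply: measurable_funTS; exact: measurableT_comp.
apply/funext => w; case: bP => [cF|dF]; last by rewrite (dvgP dF).
have cE : E ^~ w @ \oo --> (limn (F ^~ w))%:E
    by apply: cvg_EFin; [exact: nearW|exact: cF].
by have [_ sE] := cvg_limn_einf_sup cE; rewrite /S sE.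
Qed.

End measurability.

Section statement_variables.
Context d (T : measurableType d) (R : realType) (P : probability T R).

Definition mk_rv (f : T -> R) (mf : measurable_fun [set: T] f) : {RV P >-> R} :=
  HB.pack f (isMeasurableFun.Build _ _ _ _ f mf).

Section picker.
Context n (U : 'I_n -> {RV P >-> R}).

Definition travel_time_rv : {RV P >-> R} :=
  mk_rv (measurable_travel_time (fun k => measurable_funPT (U k))).

Lemma measurable_scaled_gap :
  measurable_fun [set: T] (fun w => n.+1%:R * (1 - travel_time_rv w)).
Proof. by apply: measurable_funM => //; exact: measurable_funB. Qed.

Definition scaled_gap_rv : {RV P >-> R} := mk_rv measurable_scaled_gap.

End picker.

(* The variables are indexed from 0: X j stands for X_(j+1), with weight
   1 / (2 ^ (j + 1) - 1).  The limit is 0 where the series diverges. *)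
Definition weighted_sum (X : nat -> {RV P >-> R}) (w : T) : R :=
  limn (fun m => \sum_(0 <= j < m) (2 ^+ j.+1 - 1)^-1 * X j w).

Lemma measurable_weighted_sum X : measurable_fun [set: T] (weighted_sum X).
Proof.
apply: measurable_limn => m; apply: measurable_sum => j.
exact: measurable_funM.
Qed.

Definition limit_rv (X X' : nat -> {RV P >-> R}) : {RV P >-> R} :=
  mk_rv (measurable_maxr (measurable_weighted_sum X)
                         (measurable_weighted_sum X')).

End statement_variables.

(* The distribution function on [0, +oo[ of weighted_sum X when the X j are
   independent exponential variables of mean 1. *)
Definition limit_P {R : realType} (t : R) : R :=
  1 - limn (fun m => \sum_(1 <= j < m)
        (-1) ^+ (j - 1) * 2 ^+ j * expR (- (2 ^+ j - 1) * t) *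
        \prod_(1 <= l < j.+1) (2 ^+ l - 1)^-1).

(* Main.v *)
(* Put D h k = (h k - h (k + 1)) / 2 ^ k and e_t k = exp (- (2 ^ k - 1) t).
   Revealing the points U_k one by one, from the smallest and from the largest,
   and integrating out each time, one finds exactly that the first m inequalities
   D_(j,n) - U_(j-1:n) < s and the first m' mirrored ones hold together with
   probability (D^m D'^m' h)(0, 0), where D and D' act on the two arguments of
   h k l = (1 - (2 ^ k - 1) s - (2 ^ l - 1) s)_+ ^ n.  For s = t / (n + 1) this
   tends to the product of (D^m e_t)(0) and (D^m' e_t)(0) as n grows, and the
   remaining n - m inequalities cost at most O((3 / 4) ^ m), uniformly in n.
   On the other side, (D^m e_t)(0) is also the probability that
   X_1 / (2 ^ 1 - 1) + ... + X_m / (2 ^ m - 1) <= t: it satisfies the convolution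
   recursion because D^(m+1) (2 ^ (m + 1) - 2 ^ k) h = (2 ^ (m + 1) - 1) D^m h
   at 0.  Finally (D^m h)(0) tends to sum_j (-1) ^ j a_j h j with
   a_j = 2 ^ j / prod_(l <= j) (2 ^ l - 1), because this functional is invariant
   under D; for h = e_t it is P(t). *)
Require Import Defs.
From HB Require Import structures.
From mathcomp Require Import all_boot all_order all_algebra finmap.
From mathcomp Require Import all_classical all_reals all_analysis.
From mathcomp Require Import exponential_distribution uniform_distribution.
From mathcomp Require Import measurable_realfun.
From mathcomp Require Import ring lra zify.

Set Implicit Arguments.
Unset Strict Implicit.
Unset Printing Implicit Defensive.

Import Order.TTheory GRing.Theory Num.Theory.
Import numFieldNormedType.Exports.

Local Open Scope classical_set_scope.
Local Open Scope ring_scope.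

(** * Iterated halved differences and their limit *)

(** Each inequality couples a spacing with all the preceding ones. The computation is exact because
    [D_j - U_(j-1) < s] reads [U_j < 2 U_(j-1) + s], and [x -> 2 x + s] sends the form
    [2 ^ k x + (2 ^ k - 1) s] to the same form with [k + 1]. Integrating over the window from [x] to
    [2 x + s] is then a difference in [k] divided by the slope [2 ^ k]: this is the origin of [D].
    The obstacle is that a point can be revealed from one side only: the exact formula asks for
    [m + m' <= n], whereas the travel time involves n inequalities on both sides. One-sided formulas
    do reach length n, and comparing lengths m and n on each side bounds the truncation error. The
    rate [3 / 4] depends on a sup bound alone, hence the uniformity in n. *)

Lemma exp2_ge1 {R : realType} k : 1 <= (2 : R) ^+ k.
Proof. by rewrite exprn_ege1// ler1n. Qed.

Section halved_differences.
Context {R : realType}.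
Implicit Types (h : nat -> R) (B : R) (m k j : nat).

Definition hdiff h k : R := (h k - h k.+1) / 2 ^+ k.

(* hsum m h is the sum over k <= m of (-1) ^ k e_k h k, where e_k is the k-th
   elementary symmetric polynomial of 1, 1 / 2, ..., 1 / 2 ^ (m - 1). *)
Definition hsum m h : R := iter m hdiff h 0%N.

Lemma hdiffE h k : hdiff h k = (h k - h k.+1) / 2 ^+ k.
Proof. by []. Qed.

Lemma hsumS m h : hsum m.+1 h = hsum m (hdiff h).
Proof. by rewrite /hsum iterSr. Qed.

Lemma hsum0 h : hsum 0 h = h 0%N. Proof. by []. Qed.

Lemma eq_hsum m h1 h2 : h1 =1 h2 -> hsum m h1 = hsum m h2.
Proof. by move=> /funext ->. Qed.

Lemma hsumZ m c h : hsum m (fun k => c * h k) = c * hsum m h.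
Proof.
elim: m h => [//|m ih] h; rewrite !hsumS -ih; apply: eq_hsum => k.
by rewrite hdiffE -mulrBr mulrA.
Qed.

Lemma hsumB m h1 h2 : hsum m (fun k => h1 k - h2 k) = hsum m h1 - hsum m h2.
Proof.
elim: m h1 h2 => [//|m ih] h1 h2; rewrite !hsumS -ih; apply: eq_hsum => k.
by rewrite hdiffE -mulrBl; congr (_ / _); ring.
Qed.

Lemma hsum_cst m c : hsum m.+1 (fun=> c) = 0.
Proof.
rewrite hsumS (@eq_hsum _ _ (fun=> 0 * 0)); last first.
  by move=> k; rewrite /hdiff subrr !mul0r.
by rewrite hsumZ mul0r.
Qed.

Lemma hsum_delta m : hsum m (fun k => (k == 0%N)%:R) = 1.
Proof.
elim: m => [//|m ih]; rewrite hsumS -[RHS]ih; apply: eq_hsum => k.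
by rewrite hdiffE subr0; case: k => [|k]/=; rewrite ?mul0r// expr0 divr1.
Qed.

Lemma iter_hdiff_shift m h k :
  iter m hdiff (fun j => h j.+1) k = 2 ^+ m * iter m hdiff h k.+1.
Proof.
elim: m k => [|m ih] k; first by rewrite expr0 mul1r.
rewrite !iterS !hdiffE !ih !exprS; have : (2 : R) ^+ k != 0 by rewrite expf_neq0.
by move=> ?; field.
Qed.

(* If M multiplies by 2 ^ k and T shifts, then hdiff M = 1 - 2 T and
   hdiff T = 2 T hdiff. *)
Lemma hsum_eigen m h :
  hsum m.+1 (fun k => (2 ^+ m.+1 - 2 ^+ k) * h k) = (2 ^+ m.+1 - 1) * hsum m h.
Proof.
under eq_hsum do rewrite mulrBl.
rewrite hsumB hsumZ [X in _ - X]hsumS.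
rewrite [X in _ - X](@eq_hsum _ _ (fun k => h k - 2 * h k.+1)); last first.
  move=> k; rewrite hdiffE exprS; have : (2 : R) ^+ k != 0 by rewrite expf_neq0.
  by move=> ?; field.
rewrite hsumB hsumZ /hsum iter_hdiff_shift /= hdiffE expr0 divr1 exprS.
ring.
Qed.

Lemma cvg_hsum m (F : set_system nat) {FF : Filter F} (f : nat -> nat -> R) h :
  (forall k, f n k @[n --> F] --> h k) ->
  hsum m (f n) @[n --> F] --> hsum m h.
Proof.
elim: m f h => [|m ih] f h fh; first exact: fh.
under eq_fun do rewrite hsumS.
rewrite hsumS; apply: ih => k; apply: cvgMl; exact: cvgB.
Qed.

Lemma is_derive_hsum m (x : R) (f : nat -> R -> R) (df : nat -> R) :
  (forall k, is_derive x 1 (f k) (df k)) ->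
  is_derive x 1 (fun y => hsum m (f ^~ y)) (hsum m df).
Proof.
elim: m f df => [|m ih] f df fdf; first exact: fdf.
under eq_fun do rewrite hsumS.
rewrite hsumS; apply: ih => k; rewrite hdiffE.
under eq_fun do rewrite mulrC.
by rewrite mulrC; apply: is_deriveZ; exact: is_deriveB.
Qed.

(** A plain sup bound loses to the difference what the division by [2 ^ k] gains at index 1.
    Weighting index 1 by 1 and the later ones by 1/2 gives a contraction: [(1 + 1/2) / 2 = 3/4] at
    index 1, and at most [(1/2 + 1/2) / 4 <= 3/4 * 1/2] beyond. The factor 2 in [2 * B] makes the
    weight 1/2 admissible at m = 0. *)
Lemma iter_hdiff_le m h B : 0 <= B -> (forall k, `|h k| <= B) ->
  forall k, `|iter m hdiff h k.+1| <= 2 * B * (3 / 4) ^+ m *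
    (if k == 0%N then 1 else 1 / 2).
Proof.
move=> B0 hB; elim: m => [|m ih] k /=.
  by rewrite expr0; apply: (le_trans (hB _)); case: ifP => _; lra.
set C := 2 * B * _ in ih *.
have C0 : 0 <= C by rewrite !mulr_ge0 ?exprn_ge0.
have -> : 2 * B * (3 / 4) ^+ m.+1 = 3 / 4 * C by rewrite /C exprS; ring.
rewrite hdiffE normrM normfV (@ger0_norm _ (_ ^+ _)) ?exprn_ge0//.
rewrite ler_pdivrMr ?exprn_gt0//.
apply: (le_trans (ler_normB _ _)); apply: (le_trans (lerD (ih k) (ih k.+1))).
case: k => [|k] /=; first by rewrite expr1; lra.
have := @exp2_ge1 R k.
by rewrite !exprS; nra.
Qed.

End halved_differences.

(** * The limiting alternating series *)

Section euler_series.
Context {R : realType}.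
Implicit Types (h : nat -> R) (B : R) (m k j : nat).

(** By Euler's identity this is the j-th elementary symmetric function of the infinite sequence 1,
    1/2, 1/4, ..., the limit of the coefficients [e_j] of [hsum m]. *)
Definition ecoef j : R := 2 ^+ j * \prod_(1 <= l < j.+1) (2 ^+ l - 1)^-1.

Definition etail h : R := limn (fun m => \sum_(0 <= j < m) (-1) ^+ j * ecoef j * h j).

Lemma ecoefS j : ecoef j.+1 = 2 * ecoef j / (2 ^+ j.+1 - 1).
Proof. by rewrite /ecoef big_nat_recr//= exprS; ring. Qed.

Lemma ecoef_ge0 j : 0 <= ecoef j.
Proof.
rewrite /ecoef mulr_ge0 ?exprn_ge0// prodr_ge0// => l _.
by rewrite invr_ge0 subr_ge0 exp2_ge1.
Qed.

Lemma normr_ecoef j (x : R) : `|(-1) ^+ j * ecoef j * x| = ecoef j * `|x|.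
Proof.
by rewrite 2!normrM normrX normrN normr1 expr1n mul1r ger0_norm ?ecoef_ge0.
Qed.

(** Consecutive coefficients have ratio [2 / (2 ^ (j + 1) - 1)], at most [2 / 3] except for the
    first ratio, which is 2; the factor 4 absorbs it. *)
Lemma ecoef_le j : ecoef j <= 4 * (2 / 3) ^+ j.
Proof.
case: j => [|j]; first by rewrite /ecoef big_geq// !expr0; lra.
elim: j => [|j ih].
  by rewrite /ecoef big_nat1 !expr1 (_ : 2 - 1 = 1 :> R) ?invr1; [lra|ring].
rewrite ecoefS ler_pdivrMr; last first.
  by rewrite subr_gt0 exprn_egt1// ltr1n.
have e0 := ecoef_ge0 j.+1.
have := @exp2_ge1 R j.
move: ih; rewrite !exprS; set a := ecoef _ in e0 *; set p := _ ^+ j; set q := 2 ^+ j.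
move=> ap q1.
have q4 : 3 <= 2 * (2 * q) - 1 by lra.
by nra.
Qed.

Lemma ecoef_cvg0 : ecoef @ \oo --> (0 : R).
Proof.
apply: (@squeeze_cvgr _ _ _ _ (cst 0) (fun j => 4 * (2 / 3) ^+ j)).
- by apply: nearW => j; rewrite ecoef_ge0 ecoef_le.
- exact: cvg_cst.
- rewrite -[X in _ --> X](mulr0 (4 : R)); apply: cvgMr.
  by apply: cvg_expr; rewrite ger0_norm; lra.
Qed.

Lemma is_cvg_etail h B : (forall k, `|h k| <= B) ->
  cvgn (fun m => \sum_(0 <= j < m) (-1) ^+ j * ecoef j * h j).
Proof.
move=> hB; have B0 : 0 <= B := le_trans (normr_ge0 _) (hB 0%N).
apply: normed_cvg.
apply: (@series_le_cvg _ _ (geometric (4 * B) (2 / 3))) => [k|k|k|].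
- exact: normr_ge0.
- by rewrite !mulr_ge0 ?exprn_ge0.
- rewrite /= normr_ecoef.
  apply: (le_trans (ler_pM (ecoef_ge0 k) (normr_ge0 _) (ecoef_le k) (hB k))).
  by rewrite mulrAC.
- by apply: is_cvg_geometric_series; rewrite ger0_norm; lra.
Qed.

(** Summation by parts: for j >= 1 the coefficient of [h j] on the left is, up to sign, [ecoef j / 2
    ^ j + ecoef (j - 1) / 2 ^ (j - 1)], which is [ecoef j] by [ecoefS]. Truncation leaves the single
    boundary term in [E], which vanishes with [ecoef]. *)
Lemma etail_hdiff h B : (forall k, `|h k| <= B) -> etail (hdiff h) = etail h.
Proof.
move=> hB; have B0 : 0 <= B := le_trans (normr_ge0 _) (hB 0%N).
have E N : \sum_(0 <= j < N.+1) (-1) ^+ j * ecoef j * hdiff h j =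
   \sum_(0 <= j < N.+1) (-1) ^+ j * ecoef j * h j -
   (-1) ^+ N * ecoef N / 2 ^+ N * h N.+1.
  elim: N => [|N ih].
    by rewrite !big_nat1 hdiffE !expr0; field.
  rewrite big_nat_recr//= ih [in RHS]big_nat_recr//= hdiffE ecoefS !exprS.
  have p1 := @exp2_ge1 R N.
  by field; apply/andP; split; apply/eqP; lra.
have cv := @is_cvg_etail _ _ hB.
apply/cvg_lim => //.
rewrite -(cvg_shiftS (fun m => \sum_(0 <= j < m) _)) /=.
under eq_fun do rewrite E.
rewrite -(subr0 (etail h)); apply: cvgB.
  by rewrite (cvg_shiftS (fun m => \sum_(0 <= j < m) (-1) ^+ j * ecoef j * h j)).
apply/norm_cvg0P.
apply: (@squeeze_cvgr _ _ _ _ (cst 0) (fun j => ecoef j * B)).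
- apply: nearW => j; rewrite normr_ge0 /= -mulrA -mulrA mulrA normr_ecoef normrM.
  rewrite ler_wpM2l ?ecoef_ge0// -[leRHS]mul1r ler_pM//.
  by rewrite normfV ger0_norm ?exprn_ge0// invf_le1 ?exprn_gt0// exp2_ge1.
- exact: cvg_cst.
- by rewrite -[X in _ --> X](mul0r B); apply: cvgMl; exact: ecoef_cvg0.
Qed.

(** The term of index 0 is [h 0] itself, and [12 = 4 / (1 - 2 / 3)] sums the geometric bound
    [ecoef_le]. This serves both for iterated differences, small off index 0, and for [eweight K]
    with K large. *)
Lemma etail_near0 h B : 0 <= B -> (forall k, `|h k.+1| <= B) ->
  `|etail h - h 0%N| <= 12 * B.
Proof.
move=> B0 hB.
have hb k : `|h k| <= Num.max `|h 0%N| B.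
  by rewrite le_max; case: k => [|k]; rewrite ?lexx// hB orbT.
have cv := @is_cvg_etail _ _ hb.
have geo N : \sum_(0 <= j < N) 4 * (2 / 3) ^+ j * B <= 12 * B.
  have -> : \sum_(0 <= j < N) 4 * (2 / 3) ^+ j * B = 12 * B * (1 - (2 / 3) ^+ N).
    elim: N => [|N ih]; first by rewrite big_geq// expr0; lra.
    by rewrite big_nat_recr//= ih exprS; field.
  have : 0 <= (2 / 3 : R) ^+ N by rewrite exprn_ge0.
  by nra.
have: (fun N => `|\sum_(0 <= j < N) (-1) ^+ j * ecoef j * h j - h 0%N|) @ \oo -->
      `|etail h - h 0%N|.
  by apply: cvg_norm; apply: cvgB => //; exact: cvg_cst.
move=> /cvg_lim <-//; apply: limr_le.
  by apply: is_cvg_norm; apply: is_cvgB => //; exact: is_cvg_cst.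
exists 1%N => // N /= N0.
rewrite big_ltn// {1}/ecoef big_geq// !expr0 !mul1r addrC addKr.
apply: (le_trans (ler_norm_sum _ _ _)).
apply: le_trans (geo N); rewrite [leRHS]big_ltn//.
rewrite ler_wpDl ?mulr_ge0 ?exprn_ge0//.
apply: ler_sum_nat => -[//|k] _.
rewrite normr_ecoef.
by rewrite ler_pM ?ecoef_ge0 ?ecoef_le.
Qed.

Lemma hdiff_bounded h B : (forall k, `|h k| <= B) -> forall k, `|hdiff h k| <= 2 * B.
Proof.
move=> hB k; rewrite hdiffE normrM normfV (@ger0_norm _ (_ ^+ _)) ?exprn_ge0//.
have B0 : 0 <= B := le_trans (normr_ge0 _) (hB 0%N).
rewrite ler_pdivrMr ?exprn_gt0//; apply: (le_trans (ler_normB _ _)).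
have := hB k; have := hB k.+1.
have := @exp2_ge1 R k.
by nra.
Qed.

(** By invariance [h] may be replaced by [iter m hdiff h] inside [etail]; its entry of index 0 is
    [hsum m h] and the others are small. The coefficients of [hsum m] never have to be computed. *)
Lemma hsum_etail m h B : (forall k, `|h k| <= B) ->
  `|etail h - hsum m h| <= 24 * B * (3 / 4) ^+ m.
Proof.
move=> hB; have B0 : 0 <= B := le_trans (normr_ge0 _) (hB 0%N).
have -> : etail h = etail (iter m hdiff h).
  elim: m h B hB {B0} => [//|n ih] h B hB.
  by rewrite iterSr -(ih _ _ (hdiff_bounded hB)) (etail_hdiff hB).
have -> : 24 * B * (3 / 4) ^+ m = 12 * (2 * B * (3 / 4) ^+ m) by ring.
apply: etail_near0; first by rewrite !mulr_ge0 ?exprn_ge0.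
move=> k; apply: (le_trans (iter_hdiff_le m B0 hB k)).
by rewrite ler_piMr ?mulr_ge0 ?exprn_ge0//; case: ifP => _; lra.
Qed.

Lemma cvg_hsum_etail h B : (forall k, `|h k| <= B) ->
  hsum m h @[m --> \oo] --> etail h.
Proof.
move=> hB; apply/subr_cvg0/norm_cvg0P.
apply: (@squeeze_cvgr _ _ _ _ (cst 0) (fun m => 24 * B * (3 / 4) ^+ m)).
- by apply: nearW => m; rewrite normr_ge0 distrC hsum_etail.
- exact: cvg_cst.
- rewrite -(mulr0 (24 * B)); apply: cvgMr.
  by apply: cvg_expr; rewrite ger0_norm; lra.
Qed.

Definition eweight (t : R) k : R := expR (- (2 ^+ k - 1) * t).

Lemma eweight_ge0 t k : 0 <= eweight t k.
Proof. exact: expR_ge0. Qed.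

Lemma eweight_le1 t k : 0 <= t -> `|eweight t k| <= 1.
Proof.
move=> t0; rewrite ger0_norm ?eweight_ge0// expR_le1 mulNr oppr_le0 mulr_ge0//.
by rewrite subr_ge0 exp2_ge1.
Qed.

(** The leading 1 of [limit_P] is the term of index 0 of the series. *)
Lemma limit_PE (t : R) : 0 <= t -> limit_P t = etail (eweight t).
Proof.
move=> t0; rewrite /limit_P.
have E m : \sum_(1 <= j < m.+1) (-1) ^+ (j - 1) * 2 ^+ j * expR (- (2 ^+ j - 1) * t) *
        \prod_(1 <= l < j.+1) (2 ^+ l - 1)^-1 =
   1 - \sum_(0 <= j < m.+1) (-1) ^+ j * ecoef j * eweight t j.
  rewrite [in RHS]big_ltn// /eweight {1}/ecoef [in RHS]big_geq// !expr0 subrr.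
  rewrite oppr0 mul0r expR0 !mulr1 opprD addrA subrr add0r -sumrN.
  rewrite [LHS]big_nat [RHS]big_nat; apply: eq_bigr => -[//|j] _.
  by rewrite subn1 /= /ecoef [in RHS](exprS (-1)); set e := expR _; ring.
apply/eqP; rewrite subr_eq addrC -subr_eq eq_sym; apply/eqP/cvg_lim => //.
rewrite -(cvg_shiftS (fun m => \sum_(1 <= j < m) _)) /=.
under eq_fun do rewrite E.
apply: cvgB; first exact: cvg_cst.
rewrite (cvg_shiftS (fun m => \sum_(0 <= j < m) (-1) ^+ j * ecoef j * eweight t j)).
exact: is_cvg_etail (fun k => eweight_le1 k t0).
Qed.

End euler_series.

(** * Independence and Fubini *)

Lemma measurable_bool_set d (T : measurableType d) (b : T -> bool) :
  measurable_fun [set: T] b -> measurable [set w | b w].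
Proof.
by move=> mb; rewrite -[X in measurable X]setTI; exact: (mb measurableT [set true]).
Qed.

Lemma measurable_preimage_RV d (T : measurableType d) (R : realType)
    (P : probability T R) (Z : {RV P >-> R}) (A : set R) :
  measurable A -> measurable (Z @^-1` A).
Proof. by move=> mA; rewrite -[X in measurable X]setTI; exact: measurable_funPT. Qed.

Section independence.
Context d (T : measurableType d) (R : realType) (P : probability T R).
Context (I : choiceType) (X : I -> {RV P >-> R}).
Hypothesis X_indep : mutually_independent X.
Implicit Types (J : seq I) (k : I).

Definition cylinder J : set_system T :=
  [set E | exists2 A : I -> set R, (forall i, measurable (A i)) &
     E = \bigcap_(i in [set` J]) (X i @^-1` A i)].

Lemma measurable_cylinder J : cylinder J `<=` measurable.
Proof.
move=> E [A mA ->]; apply: fin_bigcap_measurable; first exact: finite_seq.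
by move=> i _; exact: measurable_preimage_RV.
Qed.

Lemma cylinder_setI J : setI_closed (cylinder J).
Proof.
move=> E F [A mA ->] [B mB ->]; exists (fun i => A i `&` B i).
  by move=> i; exact: measurableI.
by rewrite -bigcapI.
Qed.

Lemma cylinderT J : cylinder J setT.
Proof.
exists (fun=> setT) => //; apply/seteqP; split => // w _ i _ //.
Qed.

Lemma cylinder_preimage J k (A : set R) : k \in J -> measurable A ->
  cylinder J (X k @^-1` A).
Proof.
move=> kJ mA; exists (fun i => if i == k then A else setT).
  by move=> i; case: ifP.
apply/seteqP; split => w /=.
  by move=> Aw i _ /=; case: eqP => // ->.
by move=> /(_ k kJ) /=; rewrite eqxx.
Qed.

(** The carrier is still T, with the sigma-algebra generated by the [X i], i in J. As a type, it
    allows the product [R * sigma_rv J], on which Fubini isolates one further variable. *)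
Definition sigma_rv J := g_sigma_algebraType (cylinder J).

Lemma measurable_sigma_rv J : (@measurable _ (sigma_rv J)) `<=` @measurable _ T.
Proof. by apply: smallest_sub => //; [exact: sigma_algebra_measurable|exact:
  measurable_cylinder]. Qed.

Lemma measurable_rv_sigma_rv J k : k \in J ->
  measurable_fun [set: sigma_rv J] (X k : sigma_rv J -> R).
Proof.
move=> kJ _ A mA; rewrite setTI; apply: sub_sigma_algebra.
exact: cylinder_preimage.
Qed.

Lemma indep_cylinder J k (A : set R) (E : set T) : k \notin J ->
  measurable A -> cylinder J E ->
  P (X k @^-1` A `&` E) = (P (X k @^-1` A) * P E)%E.
Proof.
move=> kJ mA [B mB ->].
pose F := [fset i | i in J]%fset.
have kF : k \notin F by rewrite in_fset.
pose C i := if i == k then A else B i.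
have mC i : measurable (C i) by rewrite /C; case: ifP.
have FJ : [set` F] = [set` J] by apply/seteqP; split => i /=; rewrite in_fset.
have := X_indep (k |` F)%fset mC.
rewrite big_fsetU1//= {2}/C eqxx set_fsetU1 bigcap_setU1 {1}/C eqxx FJ.
have -> : \bigcap_(i in [set` J]) (X i @^-1` C i) =
          \bigcap_(i in [set` J]) (X i @^-1` B i).
  apply: eq_bigcapr => i /= iJ; rewrite /C; case: eqP => // ik.
  by rewrite -ik iJ in kJ.
move=> ->; congr (_ * _)%E; rewrite -FJ X_indep//.
apply: eq_big_seq => i iF; rewrite /C; case: eqP => // ik.
by rewrite ik (negbTE kF) in iF.
Qed.

(** As functions of E both sides are finite measures agreeing on the pi-system [cylinder J]. *)
Lemma indep_sigma_rv J k (A : set R) (E : set (sigma_rv J)) : k \notin J ->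
  measurable A -> measurable E ->
  P (X k @^-1` A `&` E) = (P (X k @^-1` A) * P E)%E.
Proof.
move=> kJ mA mE; have mXA := measurable_preimage_RV (X k) mA.
pose p : {nonneg R} := NngNum (fine_ge0 (measure_ge0 P (X k @^-1` A))).
have pE : P (X k @^-1` A) = p%:num%:E by rewrite /= fineK// fin_num_measure.
pose m1 : {measure set T -> \bar R} := mrestr P mXA.
pose m2 : {measure set T -> \bar R} := mscale p P.
suff : m1 E = m2 E by rewrite /m1 /m2 /mrestr/= /mscale/= setIC pE.
apply: (g_sigma_algebra_measure_unique (cylinder J) _ (fun=> setT)) => //.
- exact: measurable_cylinder.
- by move=> _; exact: cylinderT.
- by rewrite bigcup_const//; exists 0%N.
- exact: cylinder_setI.
- by move=> F cF; rewrite /= /mrestr /mscale /= setIC -pE (indep_cylinder kJ).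
- by move=> _; rewrite /= /mrestr setTI -ge0_fin_numE// fin_num_measure.
Qed.

Lemma measurable_id_sigma_rv J : measurable_fun [set: T] (id : T -> sigma_rv J).
Proof. by move=> _ E mE; rewrite setTI; exact: (@measurable_sigma_rv J E mE). Qed.

Definition id_sigma_rv J : {mfun T >-> sigma_rv J} :=
  HB.pack (id : T -> sigma_rv J)
    (isMeasurableFun.Build _ _ _ _ _ (@measurable_id_sigma_rv J)).

Lemma measurable_section J (A : set (R * sigma_rv J)) : measurable A ->
  measurable_fun [set: R] (fun z => P [set w | A (z, w)]).
Proof.
move=> mA; have := measurable_fun_xsection (distribution P (id_sigma_rv J)) mA.
apply: eq_measurable_fun => z _; rewrite /= /distribution /pushforward /=.
by congr (P _); apply/seteqP; split => w /=; rewrite /xsection/= inE.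
Qed.

(** Freezing of one variable: by independence the joint law of [X k] and of the identity into
    [sigma_rv J] is a product measure. *)
Lemma indep_fubini J k (A : set (R * sigma_rv J)) : k \notin J -> measurable A ->
  P [set w | A (X k w, w)] =
  (\int[distribution P (X k)]_z P [set w | A (z, w)])%E.
Proof.
move=> kJ mA.
have mpr : measurable_fun [set: T] (fun w => (X k w, w : sigma_rv J)).
  by apply/measurable_fun_pairP; split => /=; [|exact: measurable_id_sigma_rv].
pose pr : {mfun T >-> (R * sigma_rv J)%type} :=
  HB.pack (fun w => (X k w, w : sigma_rv J)) (isMeasurableFun.Build _ _ _ _ _ mpr).
pose m' := distribution P pr.
rewrite -[LHS]/(m' A).
have <- : (distribution P (X k) \x distribution P (id_sigma_rv J))%E A = m' A.
  apply: product_measure_unique => // B C mB mC.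
  rewrite -[LHS]/(P (X k @^-1` B `&` C)) (@indep_sigma_rv J)//.
apply: eq_integral => z _; rewrite /= /distribution /pushforward /=.
by congr (P _); apply/seteqP; split => w /=; rewrite /xsection/= inE.
Qed.

End independence.

(** * Integrals *)

Section integrals.
Context {R : realType}.
Local Notation leb := (@lebesgue_measure R).

(** Uniqueness of densities identifies the Radon-Nikodym derivative of [nu] with [p] almost
    everywhere, and the change of variables is available for that derivative. *)
Lemma ge0_integral_density (nu : {finite_measure set (measurableTypeR R) -> \bar R})
  (p : R -> R)
    (f : R -> \bar R) :
  measurable_fun setT p -> (forall x, 0 <= p x) ->
  (forall A : set R, measurable A -> nu A = \int[leb]_(x in A) (p x)%:E)%E ->
  measurable_fun setT f -> (forall x, 0 <= f x)%E ->
  (\int[nu]_x f x = \int[leb]_x (f x * (p x)%:E))%E.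
Proof.
move=> mp p0 nup mf f0.
have dom : nu `<< leb.
  apply/null_content_dominatesP => A mA A0; rewrite nup//.
  apply: null_set_integral => //; apply: measurable_funTS; exact/measurable_EFinP.
rewrite -(Radon_Nikodym_SigmaFinite.change_of_variables dom)//.
have mrn := measurable_int _ (Radon_Nikodym_SigmaFinite.f_integrable dom).
apply: ae_eq_integral => //.
- exact: emeasurable_funM.
- by apply: emeasurable_funM => //; exact/measurable_EFinP.
- apply: ae_eqe_mul2l; apply: integral_ae_eq => //.
  + exact: Radon_Nikodym_SigmaFinite.f_integrable.
  + exact/measurable_EFinP.
  + move=> E _ mE; rewrite -nup//.
    by rewrite -Radon_Nikodym_SigmaFinite.f_integral.
Qed.

Lemma ge0_integral_law d (T : measurableType d) (P : probability T R)
    (X : {RV P >-> R}) (p : R -> R) (f : R -> \bar R) :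
  measurable_fun setT p -> (forall x, 0 <= p x) ->
  has_law X (fun A => \int[leb]_(x in A) (p x)%:E)%E ->
  measurable_fun setT f -> (forall x, 0 <= f x)%E ->
  (\int[distribution P X]_x f x = \int[leb]_x (f x * (p x)%:E))%E.
Proof.
move=> mp p0 lawX mf f0; rewrite ge0_integral_distribution//.
pose XR : {mfun T >-> measurableTypeR R} := HB.pack (X : T -> measurableTypeR R)
  (isMeasurableFun.Build _ _ _ (measurableTypeR R) _ (measurable_funPT X)).
rewrite -(@ge0_integral_density (distribution P XR))//.
by rewrite ge0_integral_distribution.
Qed.

Lemma integral_FTC (f F : R -> R) (a b : R) : a < b ->
  (forall x : R, is_derive x 1 F (f x)) -> (forall x : R, derivable f x 1) ->
  (\int[leb]_(x in `[a, b]) (f x)%:E = (F b - F a)%:E)%E.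
Proof.
move=> ab dF df; rewrite EFinB; apply: continuous_FTC2 => //.
- apply: derivable_within_continuous => x _; exact: df.
- have cF x : {for x, continuous F}.
    by apply: differentiable_continuous; apply/derivable1_diffP; have dFx := dF x;
      exact: ex_derive.
  split; first by move=> x _; have dFx := dF x; exact: ex_derive.
  + by apply: cvg_at_right_filter; exact: cF.
  + by apply: cvg_at_left_filter; exact: cF.
- by move=> x _; have dFx := dF x; rewrite derive1E derive_val.
Qed.

Lemma is_derive_affineX (A a z : R) n :
  is_derive z 1 (fun z => (A - a * z) ^+ n) (- (n%:R * (A - a * z) ^+ n.-1 * a)).
Proof.
have d1 : is_derive z 1 (cst A - a \*: id) (- a).
  have := is_deriveB (is_derive_cst A z 1) (is_deriveZ a (is_derive_id z 1)).
  by rewrite sub0r /GRing.scale/= mulr1.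
have -> : (fun z => (A - a * z) ^+ n) = (cst A - a \*: id) ^+ n.
  by apply/funext => y; rewrite exprfctE.
by have := is_deriveX n d1; rewrite /GRing.scale/= mulrN.
Qed.

(** The test matters for n = 0: [trpow 0] is the indicator of [0 < y], so that away from 0 the
    derivative of [trpow n.+1] is [n.+1] times [trpow n] for every n. *)
Definition trpow n (y : R) : R := if 0 < y then y ^+ n else 0.

Lemma trpow_ge0 n y : 0 <= trpow n y.
Proof. by rewrite /trpow; case: ifPn => // y0; rewrite exprn_ge0// ltW. Qed.

Lemma trpow_le1 n y : y <= 1 -> trpow n y <= 1.
Proof. by move=> y1; rewrite /trpow; case: ifPn => // y0; rewrite exprn_ile1// ltW. Qed.

Lemma measurable_trpow n (A a : R) : measurable_fun setT (fun z => trpow n (A - a * z)).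
Proof.
have mA : measurable_fun setT (fun z : R => A - a * z).
  by apply: measurable_funB => //; exact: measurable_funM.
apply: measurable_fun_if => //.
- exact: measurable_fun_ltr.
- by apply: measurable_funTS; exact: measurable_funX.
Qed.

(** Since [A <= 1 <= a], the integrand vanishes for [z >= 1]: the right end b may exceed 1, and the
    cut-off of the uniform density is never felt. *)
Lemma integral_uniform_trpow d (T : measurableType d) (P : probability T R)
    (X : {RV P >-> R}) n (A a x b : R) :
  has_law X (uniform_prob (@ltr01 R)) ->
  0 <= x -> x <= b -> A <= 1 -> 1 <= a ->
  (\int[distribution P X]_(z in `]x, b[) (trpow n (A - a * z))%:E =
   ((trpow n.+1 (A - a * x) - trpow n.+1 (A - a * b)) / (n.+1%:R * a))%:E)%E.
Proof.
move=> lawX x0 xb A1 a1; have a0 : 0 < a by lra.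
rewrite integral_mkcond (@ge0_integral_law _ _ _ _ (uniform_pdf 0 1))//; last 4 first.
- exact: measurable_uniform_pdf.
- by move=> y; exact: uniform_pdf_ge0.
- apply: (iffLR (measurable_restrictT _ _)) => //; apply: measurable_funTS.
  by apply: measurableT_comp => //; exact: measurable_trpow.
- by move=> y; rewrite patchE; case: ifP => // _; rewrite lee_fin trpow_ge0.
pose c := Num.min b (A / a).
have cP z : (z < c) = (z < b) && (0 < A - a * z).
  by rewrite /c lt_min; congr (_ && _); rewrite ltr_pdivlMr// subr_gt0 mulrC.
transitivity (\int[leb]_z ((fun z => ((A - a * z) ^+ n)%:E) \_ `]x, c[) z)%E.
  apply: eq_integral => z _; rewrite !patchE !mem_setE !in_itv/= cP /trpow /uniform_pdf.
  case: (ltP x z) => xz /=; last by rewrite mul0e.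
  case: (ltP z b) => zb /=; last by rewrite mul0e.
  case: ifP => pz; last by rewrite mul0e.
  by rewrite subr0 invr1 ifT ?mule1//; apply/andP; split; nra.
rewrite -integral_mkcond.
have [cx|xc] := leP c x.
  rewrite (_ : `]x, c[%classic = set0); last first.
    by apply/seteqP; split => z //=; rewrite in_itv/=; lra.
  rewrite integral_set0.
  have : ~~ (x < c) by rewrite -leNgt.
  rewrite cP negb_and -leNgt; have [xb'|xb' /=] := leP b x.
    by move=> _; rewrite (_ : b = x) ?subrr ?mul0r//; lra.
  rewrite -leNgt => Ax; rewrite /trpow !ifF ?subrr ?mul0r//; apply/negbTE;
    rewrite -leNgt//.
  nra.
have mf : measurable_fun setT (fun z : R => (A - a * z) ^+ n).
  by apply: measurable_funX; apply: measurable_funB => //; exact: measurable_funM.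
rewrite -(@integral_itv_bndoo _ _ _ _ true false); last first.
  by apply: measurable_funTS; exact/measurable_EFinP.
have dF (z : R) : is_derive z 1
    (fun z => - ((n.+1%:R * a)^-1 * (A - a * z) ^+ n.+1)) ((A - a * z) ^+ n).
  have -> : (A - a * z) ^+ n = - ((n.+1%:R * a)^-1 * - (n.+1%:R * (A - a * z) ^+ n *
    a)).
    by field; rewrite gt_eqF//= pnatr_eq0.
  by apply: is_deriveN; apply: is_deriveZ; exact: is_derive_affineX.
rewrite (integral_FTC xc dF); last by move=> z; have dz := is_derive_affineX A a z n;
  exact: ex_derive.
have : x < c by []; rewrite cP => /andP[xb' Ax].
(* Either c = b, or [A - a * c = 0] and both sides vanish. *)
have -> : trpow n.+1 (A - a * b) = (A - a * c) ^+ n.+1.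
  rewrite /trpow /c /Num.min ltr_pdivlMr// (mulrC b).
  case: (ltP (a * b) A) => bA; first by rewrite subr_gt0 bA.
  have -> : A - a * (A / a) = 0 by field; rewrite gt_eqF.
  by rewrite ifF ?expr0n//; apply/negbTE; rewrite -leNgt subr_le0.
by rewrite /trpow Ax; congr EFin; ring.
Qed.

Section has_integral.
Context d (T : measurableType d) (mu : {measure set T -> \bar R}) (D : set T).
Hypothesis mD : measurable D.
Implicit Types (f g : T -> R) (F G c : R).

(** Integrability is kept together with the value because [hsum] subtracts: additivity for
    nonnegative integrands would not be enough. *)
Definition has_integral (f : T -> R) (F : R) :=
  mu.-integrable D (EFin \o f) /\ (\int[mu]_(x in D) (f x)%:E)%E = F%:E.

Lemma ge0_has_integral f F : measurable_fun D f -> (forall x, 0 <= f x) ->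
  (\int[mu]_(x in D) (f x)%:E)%E = F%:E -> has_integral f F.
Proof.
move=> mf f0 fF; split => //; apply/integrableP; split; first exact/measurable_EFinP.
by under eq_integral do rewrite /= ger0_norm//; rewrite fF ltry.
Qed.

Lemma has_integralB f F g G : has_integral f F -> has_integral g G ->
  has_integral (fun x => f x - g x) (F - G).
Proof.
move=> [fi fF] [gi gG]; split; first exact: (integrableB mD fi gi).
by under eq_integral do rewrite EFinB; rewrite integralB_EFin// fF gG.
Qed.

Lemma has_integralZ c f F : has_integral f F -> has_integral (fun x => c * f x) (c * F).
Proof.
move=> [fi fF]; split; first exact: (integrableZl mD c fi).
by under eq_integral do rewrite EFinM; rewrite integralZl//= fF.
Qed.

Lemma has_integral_hsum m (f : nat -> T -> R) (F : nat -> R) :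
  (forall k, has_integral (f k) (F k)) ->
  has_integral (fun x => hsum m (f ^~ x)) (hsum m F).
Proof.
elim: m f F => [|m ih] f F fF; first exact: fF.
under eq_fun do rewrite hsumS.
rewrite hsumS; apply: ih => k; rewrite hdiffE mulrC.
have := has_integralZ (2 ^+ k)^-1 (has_integralB (fF k) (fF k.+1)).
by congr has_integral; apply/funext => x; rewrite [LHS]mulrC.
Qed.

End has_integral.

End integrals.

(** * The limit distribution *)

Section sigma_rv_mono.
Context d (T : measurableType d) (R : realType) (P : probability T R).
Context (I : choiceType) (X : I -> {RV P >-> R}).

Lemma sub_sigma_rv (J K : seq I) (E : set T) : {subset K <= J} ->
  measurable (E : set (sigma_rv X K)) -> measurable (E : set (sigma_rv X J)).
Proof.
move=> KJ; apply: (@smallest_sub _ _ _ _ (@sigma_algebra_measurable _ (sigma_rv X J))).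
move=> F [A mA ->]; apply: sub_sigma_algebra.
exists (fun i => if i \in K then A i else setT); first by move=> i; case: ifP.
apply/seteqP; split => w /= Aw i /= iJ; first by case: ifP => // iK; exact: Aw.
by have := Aw i (KJ _ iJ); rewrite /= iJ.
Qed.

End sigma_rv_mono.

Section hypoexponential.
Context {R : realType}.

Lemma is_derive_expR_affine (A a z : R) :
  is_derive z 1 (fun z => expR (A - a * z)) (- a * expR (A - a * z)).
Proof.
have d1 := is_derive_affineX A a z 1.
have d2 := is_derive_expR ((A - a * z) ^+ 1).
have := @is_derive1_comp R expR (fun z => (A - a * z) ^+ 1) z _ _ d2 d1.
by rewrite mul1r expr0 mul1r expr1 mulrC.
Qed.

Lemma is_derive_hsum_eweight m (t c z : R) :
  is_derive z 1 (fun z => hsum m (eweight (t - c * z)))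
    (hsum m (fun k => c * (2 ^+ k - 1) * eweight (t - c * z) k)).
Proof.
apply: is_derive_hsum => k; rewrite /eweight.
have E y : - (2 ^+ k - 1) * (t - c * y) =
    - (2 ^+ k - 1) * t - (- (c * (2 ^+ k - 1))) * y :> R by ring.
have := is_derive_expR_affine (- (2 ^+ k - 1) * t) (- (c * (2 ^+ k - 1))) z.
rewrite -E opprK; congr is_derive.
by apply/funext => y; rewrite E.
Qed.

Definition hypoexp_cdf m (t : R) : R := if 0 <= t then hsum m (eweight t) else 0.

(* Writing g_m(t) for hsum m (eweight t) and lam for 2 ^ (m + 1) - 1, the
   identity hsum_eigen reads g_(m+1)' = lam (g_m - g_(m+1)), so that
   - e^(-z) g_(m+1)(t - z / lam) is a primitive of the integrand. *)
Lemma integral_hypoexp m (t p : R) : 0 <= t ->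
  let lam := 2 ^+ m.+1 - 1 in
  (\int[lebesgue_measure]_(z in `[0%R, (lam * t)%R])
     (hsum m (eweight (t - lam^-1 * z)) * expR (- z) * p)%:E =
   (hsum m.+1 (eweight t) * p)%:E)%E.
Proof.
move=> t0 lam.
have lam0 : 0 < lam by rewrite /lam subr_gt0 exprn_egt1// ltr1n.
have [->|tN0] := eqVneq t 0.
  rewrite mulr0 set_itv1 integral_set1.
  rewrite (@eq_hsum _ _ _ (fun=> 1)) ?hsum_cst ?mul0r// => k.
  by rewrite /eweight mulr0 expR0.
have t_gt0 : 0 < t by rewrite lt_neqAle eq_sym tN0.
pose G z := hsum m.+1 (eweight (t - lam^-1 * z)).
have dG (z : R) : is_derive z 1 (fun z => - p * (G z * expR (0 - 1 * z)))
    (hsum m (eweight (t - lam^-1 * z)) * expR (- z) * p).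
  have d1 := is_derive_hsum_eweight m.+1 t lam^-1 z.
  have d2 := is_derive_expR_affine 0 1 z.
  have := is_deriveZ (- p) (is_deriveM d1 d2).
  rewrite /GRing.scale/= sub0r mul1r.
  set h := eweight _; congr is_derive.
  have := hsum_eigen m h; rewrite -/lam => e.
  (* This is [hsum_eigen] divided by lam, with [2 ^ (m + 1) - 2 ^ k = lam - (2 ^ k - 1)]. The
     subtracted term is the derivative of G at z, so the line reads [hsum m h = G - G']. *)
  have -> : hsum m h = G z - hsum m.+1 (fun k => lam^-1 * (2 ^+ k - 1) * h k).
    rewrite -[LHS](mulKf (lt0r_neq0 lam0)) -e -hsumZ -hsumB.
    have lamE : 2 ^+ m.+1 = lam + 1 by rewrite /lam subrK.
    by apply: eq_hsum => k; rewrite -/h lamE; field; rewrite lt0r_neq0.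
  by rewrite -/(G z); ring.
rewrite (integral_FTC _ dG) ?mulr_gt0//; last first.
  move=> z.
  have d1 := is_derive_hsum_eweight m t lam^-1 z.
  have d2 := is_derive_expR_affine 0 1 z.
  have dp := is_deriveZ p (is_deriveM d1 d2).
  have -> : (fun z => hsum m (eweight (t - lam^-1 * z)) * expR (- z) * p) =
    p \*: ((fun z => hsum m (eweight (t - lam^-1 * z))) * (fun z => expR (0 - 1 * z))).
    apply/funext => y; rewrite -[RHS]/(p * (hsum _ _ * expR (0 - 1 * y))).
    by rewrite sub0r mul1r [LHS]mulrC.
  exact: ex_derive.
rewrite /G mulKf ?lt0r_neq0// subrr !mulr0 !subr0 expR0.
(* At the upper end [z = lam * t] all weights are 1 and G vanishes; only the lower end
   contributes. *)
rewrite (@eq_hsum _ _ (eweight 0) (fun=> 1)) ?hsum_cst; last first.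
  by move=> k; rewrite /eweight mulr0 expR0.
by congr EFin; ring.
Qed.

Definition psum d (T : measurableType d) (Y : nat -> T -> R) m (w : T) : R :=
  \sum_(0 <= j < m) (2 ^+ j.+1 - 1)^-1 * Y j w.

Section psum_law.
Context d (T : measurableType d) (P : probability T R).
Context (I : choiceType) (X : I -> {RV P >-> R}) (f : nat -> I).
Hypothesis X_indep : mutually_independent X.
Hypothesis f_inj : injective f.
Hypothesis X_exp : forall j, has_law (X (f j)) (exponential_prob 1).

Lemma measurable_psum (J : seq I) m : (forall j, (j < m)%N -> f j \in J) ->
  measurable_fun [set: sigma_rv X J] (psum (X \o f) m : sigma_rv X J -> R).
Proof.
move=> fJ; rewrite /psum.
under eq_fun do rewrite big_mkord.
apply: measurable_sum => j; apply: measurable_funM => //.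
by apply: measurable_rv_sigma_rv; exact: fJ.
Qed.

(** The event F on other variables rides along through the induction: taken as an event on the
    second series, it yields the independence of the two sums. The level t is general because
    freezing [X (f m)] at z shifts it by [z / lam]. *)
Lemma psum_cdf m (K : seq I) (F : set T) t : (forall j, f j \notin K) ->
  measurable (F : set (sigma_rv X K)) ->
  P ([set w | psum (X \o f) m w <= t] `&` F) = ((hypoexp_cdf m t)%:E * P F)%E.
Proof.
move=> fK mF; elim: m t => [|m ih] t.
  rewrite /hypoexp_cdf /psum; case: ifPn => t0.
    rewrite hsum0 /eweight expr0 subrr oppr0 mul0r expR0 mul1e; congr (P _).
    by apply/seteqP; split => w /=; rewrite big_geq// => -[].
  rewrite mul0e (_ : _ `&` _ = set0) ?measure0//.
  by apply/seteqP; split => w //=; rewrite big_geq// (negbTE t0) => -[].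
pose lam : R := 2 ^+ m.+1 - 1.
have lam0 : 0 < lam by rewrite /lam subr_gt0 exprn_egt1// ltr1n.
pose J := [seq f j | j <- iota 0 m] ++ K.
have fmJ : f m \notin J.
  rewrite mem_cat (negbTE (fK m)) orbF; apply/mapP => -[j].
  by rewrite mem_iota => /= jm /f_inj mj; rewrite mj ltnn in jm.
pose A : set (R * sigma_rv X J) :=
  [set zw | psum (X \o f) m zw.2 + lam^-1 * zw.1 <= t] `&` (snd @^-1` F).
have mA : measurable A.
  apply: measurableI.
    rewrite -[X in measurable X]setTI.
    apply: measurable_fun_le => //; apply: measurable_funD.
      apply: measurableT_comp measurable_snd; apply: measurable_psum => j jm.
      by rewrite mem_cat map_f// mem_iota.
    by apply: measurable_funM => //; exact: measurable_fst.
  rewrite -[X in measurable X]setTI; apply: measurable_snd => //.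
  by apply: sub_sigma_rv mF => i iK; rewrite mem_cat iK orbT.
have -> : [set w | psum (X \o f) m.+1 w <= t] `&` F = [set w | A (X (f m) w, w)].
  by apply/seteqP; split => w /=; rewrite /psum big_nat_recr.
rewrite (indep_fubini X_indep fmJ mA).
have PF : P F \is a fin_num.
  by rewrite fin_num_measure//; exact: measurable_sigma_rv mF.
have mpdf : measurable_fun [set: R] (exponential_pdf 1) by exact:
  measurable_exponential_pdf.
have pdf0 x : 0 <= exponential_pdf 1 x :> R by exact: exponential_pdf_ge0.
have mf : measurable_fun [set: R] (fun z => P [set w | A (z, w)]).
  exact: measurable_section.
rewrite (ge0_integral_law mpdf pdf0 (X_exp m) mf)//.
pose p := fine (P F); have pE : P F = p%:E by rewrite fineK.
have E z : P [set w | A (z, w)] = ((hypoexp_cdf m (t - lam^-1 * z)) * p)%:E.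
  rewrite EFinM -pE -ih; congr (P _); apply/seteqP.
  by split => w /=; rewrite lerBrDr.
(* The density kills [z < 0], and [hypoexp_cdf] at a negative level kills [z > lam * t]. *)
transitivity (\int[lebesgue_measure]_z
   ((fun z => (hsum m (eweight (t - lam^-1 * z)) * expR (- z) * p)%:E) \_
    `[0%R, (lam * t)%R]) z)%E.
  apply: eq_integral => z _; rewrite E patchE mem_setE in_itv/=.
  have [z0|z0] := ltP z 0; first by rewrite lt0_exponential_pdf// mule0.
  rewrite exponential_pdfE// mul1r mulN1r /hypoexp_cdf subr_ge0 ler_pdivrMl//.
  by case: ifP => _; rewrite ?mul0r ?mul0e// -EFinM mulrAC.
rewrite -integral_mkcond /hypoexp_cdf pE; case: ifPn => t0.
  by rewrite integral_hypoexp.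
rewrite mul0e set_itv_ge ?integral_set0// bnd_simp -ltNge.
by rewrite pmulr_rlt0 // ltNge.
Qed.

Lemma ae_exponential_ge0 : \forall w \ae P, forall j, 0 <= X (f j) w.
Proof.
apply/ae_foralln => j; exists (X (f j) @^-1` `]-oo, 0[%classic); split.
- exact: measurable_preimage_RV.
- rewrite -[LHS]/(distribution P (X (f j)) `]-oo, 0[%classic) X_exp//.
  rewrite /exponential_prob integral0_eq// => z; rewrite /= in_itv/= => z0.
  by rewrite lt0_exponential_pdf.
- by move=> w /=; rewrite in_itv/= ltNge => /negP.
Qed.

End psum_law.

End hypoexponential.

Lemma probabilityI_full d (T : measurableType d) (R : realType)
    (mu : probability T R) (A N : set T) :
  measurable A -> measurable N -> mu (~` N) = 0%E -> mu (A `&` N) = mu A.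
Proof.
move=> mA mN N0; have mNC := measurableC mN.
rewrite -[in RHS](setIT A) -(setUv N) setIUr measureU0//.
- exact: measurableI.
- exact: measurableI.
apply/eqP; rewrite -measure_le0 -N0.
apply: le_measure; rewrite ?inE//.
exact: measurableI.
Qed.

(** * Law of the maximum of the two series *)

Section limit_distribution.
Context d (T : measurableType d) (R : realType) (P : probability T R).
Implicit Types t : R.
Context (X X' : nat -> {RV P >-> R}).
Let Y (k : nat + nat) := match k with inl j => X j | inr j => X' j end.
Hypothesis Y_indep : mutually_independent Y.
Hypothesis X_exp : forall j, has_law (X j) (exponential_prob 1).
Hypothesis X'_exp : forall j, has_law (X' j) (exponential_prob 1).

Let nonneg : set T := \bigcap_j
  ((X j @^-1` `[0, +oo[%classic) `&` (X' j @^-1` `[0, +oo[%classic)).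

Let both_le m t := [set w | psum X m w <= t] `&` [set w | psum X' m w <= t].

Let measurable_nonneg : measurable nonneg.
Proof.
apply: bigcapT_measurable => j.
by apply: measurableI; apply: measurable_preimage_RV; exact: measurable_itv.
Qed.

Let nonneg_ae : P (~` nonneg) = 0.
Proof.
apply: measure_negligible; first exact: measurableC.
have a1 := @ae_exponential_ge0 R _ _ P _ Y inl X_exp.
have a2 := @ae_exponential_ge0 R _ _ P _ Y inr X'_exp.
have : \forall w \ae P, nonneg w.
  apply: filterS2 a1 a2 => w /= h1 h2 j _; split => /=; rewrite in_itv/= andbT.
    exact: h1.
  exact: h2.
by [].
Qed.

Let measurable_both m t : measurable (both_le m t).
Proof.
have mp (Z : nat -> {RV P >-> R}) : measurable [set w | psum Z m w <= t].
  rewrite -[X in measurable X]setTI; apply: measurable_fun_le => //.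
  by apply: measurable_sum => j; apply: measurable_funM.
exact: measurableI.
Qed.

Let both_leE m t : P (both_le m t) = (hypoexp_cdf m t ^+ 2)%:E.
Proof.
have il : injective (inl : nat -> nat + nat) by move=> ? ? [].
have ir : injective (inr : nat -> nat + nat) by move=> ? ? [].
pose K := [seq inr j | j <- iota 0 m] : seq (nat + nat).
have nK j : inl j \notin K by apply/mapP => -[].
have mK : measurable ([set w | psum X' m w <= t] : set (sigma_rv Y K)).
  rewrite -[X in measurable X]setTI; apply: measurable_fun_le => //.
  apply: (@measurable_psum R _ _ P _ Y inr K) => j jm.
  by rewrite map_f// mem_iota.
rewrite /both_le (@psum_cdf R _ _ P _ Y inl Y_indep il X_exp m K _ t nK mK).
rewrite -[X in P X]setIT.
rewrite (@psum_cdf R _ _ P _ Y inr Y_indep ir X'_exp m [::] setT t)//.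
by rewrite probability_setT mule1 -EFinM.
Qed.

(** On [nonneg] the partial sums increase, so the intersection is decreasing and its probability is
    a limit in m; on this event both series converge, with sums at most t. *)
Let good t := \bigcap_m (nonneg `&` both_le m t).

Let measurable_good t : measurable (good t).
Proof. by apply: bigcapT_measurable => m; exact: measurableI. Qed.

Let psum_nd (Z : nat -> {RV P >-> R}) w : (forall j, 0 <= Z j w) ->
  nondecreasing_seq (psum Z ^~ w).
Proof.
move=> Z0; apply/nondecreasing_seqP => m.
rewrite /psum big_nat_recr//= lerDl mulr_ge0// invr_ge0 subr_ge0.
exact: exp2_ge1.
Qed.

Let goodE t : 0 <= t -> P (good t) = (etail (eweight t) ^+ 2)%:E.
Proof.
move=> t0.
have nd : nonincreasing_seq (fun m => nonneg `&` both_le m t).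
  move=> m n mn; apply/subsetPset => w [w0 [w1 w2]]; split => //.
  split; [apply: le_trans w1|apply: le_trans w2].
    apply: (psum_nd _ mn) => j; have [] := w0 j I.
    by rewrite /= in_itv/= andbT.
  apply: (psum_nd _ mn) => j; have [_] := w0 j I.
  by rewrite /= in_itv/= andbT.
have PE m : P (nonneg `&` both_le m t) = (hsum m (eweight t) ^+ 2)%:E.
  by rewrite setIC probabilityI_full// both_leE /hypoexp_cdf t0.
have h1 : P (nonneg `&` both_le m t) @[m --> \oo] --> P (good t).
  apply: nonincreasing_cvg_mu => //.
  - by rewrite -ge0_fin_numE// fin_num_measure//; exact: measurableI.
  - by move=> m; exact: measurableI.
  - exact: measurable_good.
have h2 : P (nonneg `&` both_le m t) @[m --> \oo] --> (etail (eweight t) ^+ 2)%:E.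
  under eq_fun do rewrite PE.
  apply: cvg_EFin; first exact: nearW.
  have c1 : hsum m (eweight t) @[m --> \oo] --> etail (eweight t).
    exact: cvg_hsum_etail (fun k => eweight_le1 k t0).
  by rewrite expr2; under eq_fun do rewrite expr2; exact: cvgM.
exact: cvg_unique h1 h2.
Qed.

Let good_weighted_sum t w : good t w ->
  [/\ cvgn (psum X ^~ w), cvgn (psum X' ^~ w),
      0 <= weighted_sum X w, 0 <= weighted_sum X' w &
      weighted_sum X w <= t /\ weighted_sum X' w <= t].
Proof.
move=> gw.
have [w0 _] := gw 0%N I.
have aux (Z : nat -> {RV P >-> R}) : (forall j, 0 <= Z j w) ->
    (forall m, psum Z m w <= t) ->
    [/\ cvgn (psum Z ^~ w), 0 <= weighted_sum Z w & weighted_sum Z w <= t].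
  move=> Z0 Zt; have nd := psum_nd Z0.
  have cv : cvgn (psum Z ^~ w).
    apply: nondecreasing_is_cvgn => //; exists t => _ [m _ <-]; exact: Zt.
  split => //.
    have := nondecreasing_cvgn_le nd cv 0%N.
    by rewrite {1}/psum big_geq.
  by apply: limr_le => //; exact: nearW.
have [c1 p1 l1] : [/\ cvgn (psum X ^~ w), 0 <= weighted_sum X w & weighted_sum X w <=
  t].
  apply: aux => [j|m]; first by have [] := w0 j I; rewrite /= in_itv/= andbT.
  by have [_ []] := gw m I.
have [c2 p2 l2] : [/\ cvgn (psum X' ^~ w), 0 <= weighted_sum X' w & weighted_sum X' w
  <= t].
  apply: aux => [j|m]; first by have [_] := w0 j I; rewrite /= in_itv/= andbT.
  by have [_ []] := gw m I.
by split.
Qed.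

Let convergent := \bigcup_K good (K%:R : R).

Let measurable_convergent : measurable convergent.
Proof. exact: bigcupT_measurable. Qed.

(** [P (good K)] is [etail (eweight K) ^ 2], and [etail_near0] puts [etail (eweight K)] within
    [12 * expR (- K)] of 1. Almost sure convergence of both series thus comes from the closed form
    itself, and the default value of [weighted_sum] becomes harmless. *)
Let convergent_ae : P (~` convergent) = 0%E.
Proof.
have cE : etail (eweight (K%:R : R)) ^+ 2 @[K --> \oo] --> (1 : R).
  have c1 : etail (eweight (K%:R : R)) @[K --> \oo] --> (1 : R).
    apply/subr_cvg0/norm_cvg0P.
    apply: (@squeeze_cvgr _ _ _ _ (cst 0) (fun K => 12 * expR (- K%:R))).
    - apply: nearW => K; rewrite normr_ge0 /=.
      have e0 : eweight (K%:R : R) 0 = 1.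
        by rewrite /eweight expr0 subrr oppr0 mul0r expR0.
      rewrite -[X in _ - X]e0.
      apply: etail_near0 => [|k]; first exact: expR_ge0.
      rewrite ger0_norm ?eweight_ge0// ler_expR mulNr lerN2 ler_peMl//.
      have := @exp2_ge1 R k.
      by rewrite exprS; lra.
    - exact: cvg_cst.
    - rewrite -(mulr0 (12 : R)); apply: cvgMr; exact: cvgn_expR.
  have := cvgM c1 c1; rewrite mulr1 => c2.
  under eq_fun do rewrite expr2.
  exact: c2.
have fP : P convergent \is a fin_num by rewrite fin_num_measure.
suff P1 : P convergent = 1%E by rewrite probability_setC// P1 subee.
apply/eqP; rewrite eq_le probability_le1//= -(fineK fP) lee_fin.
rewrite -(cvg_lim _ cE)//; apply: limr_le; first by apply/cvg_ex; exists 1.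
apply: nearW => K; rewrite -lee_fin fineK// -goodE//.
by apply: le_measure; rewrite ?inE//; move=> w gw; exists K.
Qed.

Lemma cdf_limit_rv_ge0 t : 0 <= t -> cdf (limit_rv X X') t = (limit_P t ^+ 2)%:E.
Proof.
move=> t0; rewrite limit_PE// -goodE//.
have mL : measurable (limit_rv X X' @^-1` `]-oo, t]).
  by apply: measurable_preimage_RV; exact: measurable_itv.
rewrite -[LHS]/(P (limit_rv X X' @^-1` `]-oo, t])).
rewrite -(probabilityI_full mL measurable_convergent convergent_ae).
rewrite -(probabilityI_full (measurable_good t) measurable_convergent convergent_ae).
congr (P _); apply/seteqP; split => w /= [h cw]; split => //.
  move: h; rewrite in_itv/= ge_max => /andP[h1 h2].
  have [K _ gK] := cw.
  have [c1 c2 _ _ _] := good_weighted_sum gK.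
  have [w0 _] := gK 0%N I.
  move=> m _; split => //; split => /=.
    apply: le_trans h1; apply: (nondecreasing_cvgn_le _ c1) => //.
    by apply: psum_nd => j; have [] := w0 j I; rewrite /= in_itv/= andbT.
  apply: le_trans h2; apply: (nondecreasing_cvgn_le _ c2) => //.
  by apply: psum_nd => j; have [_] := w0 j I; rewrite /= in_itv/= andbT.
have [_ _ _ _ [l1 l2]] := good_weighted_sum h.
by rewrite in_itv/= ge_max l1 l2.
Qed.

Lemma cdf_limit_rv_lt0 t : t < 0 -> cdf (limit_rv X X') t = 0%E.
Proof.
move=> t0.
have mL : measurable (limit_rv X X' @^-1` `]-oo, t]).
  by apply: measurable_preimage_RV; exact: measurable_itv.
rewrite -[LHS]/(P (limit_rv X X' @^-1` `]-oo, t])).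
rewrite -(probabilityI_full mL measurable_convergent convergent_ae).
rewrite (_ : _ `&` _ = set0) ?measure0//; apply/seteqP; split => w //= [].
rewrite in_itv/= ge_max => /andP[h1 _] [K _ /good_weighted_sum[_ _ p1 _ _]].
by have := le_lt_trans (le_trans p1 h1) t0; rewrite ltxx.
Qed.

End limit_distribution.

(** * Uniform points *)

Section chain.
Context {R : realType} {I : eqType}.
Implicit Types (v u : I -> R) (base : R -> seq I -> bool) (J : seq I).

(* The m smallest values v k, k in J, are greater than x and each of them is
   less than twice the previous one (x for the first one) plus s; base holds of
   the largest of them and of the remaining indices. *)
Fixpoint chain v (s : R) base m (x : R) J : bool :=
  if m is m'.+1 then
    has (fun k => [&& x < v k, v k < 2 * x + s & chain v s base m' (v k) (rem k J)]) J
  else base x J.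

Lemma chain_gt v s base m x J :
  (forall y K, base y K -> {in K, forall k, y < v k}) ->
  chain v s base m x J -> {in J, forall k, x < v k}.
Proof.
move=> baseP; elim: m x J => [|m ih] x J /=; first exact: baseP.
move=> /hasP[k kJ /and3P[xk _ ck]] j jJ.
have [->//|jk] := eqVneq j k.
apply: (lt_trans xk); apply: ih ck _ _.
by have := jJ; rewrite (perm_mem (perm_to_rem kJ)) inE (negbTE jk).
Qed.

(** The state after both chains: x is the last point taken on the left, y the last distance to 1 on
    the right. The clause [x + y < 1] is separate because [all] is void for empty J, and the two
    sides must not cross. *)
Definition between u (x y : R) J := (x + y < 1) && all (fun k => x < u k < 1 - y) J.

Lemma chain_between u s m x y J :
  chain (fun k => 1 - u k) s (between u x) m y J -> between u x y J.
Proof.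
elim: m y J => [//|m ih] y J /= /hasP[k kJ /and3P[yk _ /ih /andP[xk /allP ak]]].
apply/andP; split; first by lra.
apply/allP => j jJ; have [->|jk] := eqVneq j k; first by apply/andP; split; lra.
have : j \in rem k J.
  by have := jJ; rewrite (perm_mem (perm_to_rem kJ)) inE (negbTE jk).
by move=> /ak /andP[? ?]; apply/andP; split; lra.
Qed.

End chain.

Section chain_measurable.
Context {R : realType} {I : eqType}.

Lemma measurable_has d (S : measurableType d) (p : I -> S -> bool) (J : seq I) :
  (forall k, k \in J -> measurable_fun [set: S] (p k)) ->
  measurable_fun [set: S] (fun s => has (p ^~ s) J).
Proof.
elim: J => [|k J ih] pJ /=; first exact: measurable_cst.
apply: measurable_or; first by apply: pJ; rewrite inE eqxx.
by apply: ih => j jJ; apply: pJ; rewrite inE jJ orbT.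
Qed.

Lemma measurable_chain d (S : measurableType d) (v : I -> S -> R) (s : R)
    (base : S -> R -> seq I -> bool) m (f : S -> R) (J : seq I) :
  (forall k, k \in J -> measurable_fun [set: S] (v k)) ->
  (forall (g : S -> R) K, {subset K <= J} -> measurable_fun [set: S] g ->
     measurable_fun [set: S] (fun z => base z (g z) K)) ->
  measurable_fun [set: S] f ->
  measurable_fun [set: S] (fun z => chain (v ^~ z) s (base z) m (f z) J).
Proof.
elim: m f J => [|m ih] f J mv mbase mf /=; first exact: mbase.
apply: (@measurable_has _ _ (fun k z => [&& f z < v k z, v k z < 2 * f z + s &
  chain (v ^~ z) s (base z) m (v k z) (rem k J)])) => k kJ.
have mvk := mv _ kJ.
apply: measurable_and; first exact: measurable_fun_ltr.
apply: measurable_and.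
  by apply: measurable_fun_ltr => //; apply: measurable_funD => //;
    exact: measurable_funM.
have sub : {subset rem k J <= J} by exact: mem_rem.
apply: ih => // [j jJ|g K KJ mg]; first exact/mv/sub.
by apply: mbase => // j /KJ /sub.
Qed.

Lemma measurable_between d (S : measurableType d) (u : I -> S -> R)
    (f g : S -> R) (J : seq I) :
  (forall k, k \in J -> measurable_fun [set: S] (u k)) ->
  measurable_fun [set: S] f -> measurable_fun [set: S] g ->
  measurable_fun [set: S] (fun z => between (u ^~ z) (f z) (g z) J).
Proof.
move=> mu mf mg; rewrite /between.
apply: measurable_and; first by apply: measurable_fun_ltr => //; exact: measurable_funD.
under eq_fun do rewrite -[all _ _]negbK -has_predC.
apply: measurable_neg; apply: (@measurable_has _ _ (fun k z => ~~ (f z < u k z < 1 -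
  g z))).
move=> k kJ; apply: measurable_neg; have muk := mu _ kJ.
apply: measurable_and; apply: measurable_fun_ltr => //; exact: measurable_funB.
Qed.

End chain_measurable.

Section chain_probability.
Context d (T : measurableType d) (R : realType) (P : probability T R).
Context (I : choiceType) (V : I -> {RV P >-> R}) (s : R).
Context (base : T -> R -> seq I -> bool) (m0 : nat) (A : nat -> R).
Implicit Types (x : R) (J : seq I) (m n l : nat) (w : T).
Hypothesis V_indep : mutually_independent V.
Hypothesis V_unif : forall k, has_law (V k) (uniform_prob (@ltr01 R)).
Hypothesis s_ge0 : 0 <= s.
Hypothesis base_gt : forall w x J, base w x J -> {in J, forall k, x < V k w}.
Hypothesis measurable_base : forall d' (S : measurableType d') (phi : S -> T)
  (f : S -> R) (J : seq I),
  (forall k, k \in J -> measurable_fun [set: S] (V k \o phi)) ->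
  measurable_fun [set: S] f -> measurable_fun [set: S] (fun z => base (phi z) (f z) J).
Hypothesis A_le1 : forall l, A l <= 1.
Hypothesis base_prob : forall x J, 0 <= x -> uniq J -> (m0 <= size J)%N ->
  P [set w | base w x J] = (hsum m0 (fun l => trpow (size J) (A l - x)))%:E.

Let vchain m x J w := chain (V ^~ w) s (base w) m x J.

Lemma measurable_chain_comp d' (S : measurableType d') (phi : S -> T)
    (f : S -> R) (J : seq I) m :
  (forall k, k \in J -> measurable_fun [set: S] (V k \o phi)) ->
  measurable_fun [set: S] f ->
  measurable_fun [set: S] (fun z => chain (V ^~ (phi z)) s (base (phi z)) m (f z) J).
Proof.
move=> mV mf; apply: (@measurable_chain _ _ _ _ (fun k z => V k (phi z))) => // g K
  KJ mg.
by apply: measurable_base => // k /KJ; exact: mV.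
Qed.

Let link m x J (k : I) w := [&& x < V k w, V k w < 2 * x + s & vchain m (V k w) (rem
  k J) w].

Let measurable_link m x J (k : I) : measurable [set w | link m x J k w].
Proof.
apply: measurable_bool_set; apply: measurable_and; first exact: measurable_fun_ltr.
apply: measurable_and; first exact: measurable_fun_ltr.
by apply: (@measurable_chain_comp _ T id).
Qed.

(** If two indices could both be chosen first, [chain_gt] would put each of the two points below the
    other. *)
Let trivIset_link m x J : uniq J ->
  trivIset [set` J] (fun k => [set w | link m x J k w]).
Proof.
move=> uJ; apply/trivIsetP => j k /= jJ kJ jk.
apply/seteqP; split => // w /= [/and3P[_ _ cj] /and3P[_ _ ck]].
have h1 : V j w < V k w.
  apply: (chain_gt (@base_gt w)) cj _ _.
  by have := kJ; rewrite (perm_mem (perm_to_rem jJ)) inE eq_sym (negbTE jk).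
have h2 : V k w < V j w.
  apply: (chain_gt (@base_gt w)) ck _ _.
  by have := jJ; rewrite (perm_mem (perm_to_rem kJ)) inE (negbTE jk).
by have := lt_trans h1 h2; rewrite ltxx.
Qed.

Let H n x k := hsum m0 (fun l => trpow n (A l - 2 ^+ k * x - (2 ^+ k - 1) * s)).

(** Freezing [V k] leaves an integral of truncated powers over the window from x to [2 * x + s]: the
    slope [2 ^ j] gives the denominator of [hdiff], and raising the exponent to [size J] gives the
    factor [(size J)^-1]. *)
Let prob_link m x J (k : I) : 0 <= x -> uniq J -> k \in J ->
  (forall z : R, 0 <= z ->
    P [set w | vchain m z (rem k J) w] = (hsum m (H (size J).-1 z))%:E) ->
  P [set w | link m x J k w] = ((size J)%:R^-1 * hsum m.+1 (H (size J) x))%:E.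
Proof.
move=> x0 uJ kJ ih; have pow2_ge1 := @exp2_ge1 R.
have n0 : (0 < size J)%N by case: (J) kJ.
pose S := (R * sigma_rv V (rem k J))%type.
pose B : set S := [set zw | [&& x < zw.1, zw.1 < 2 * x + s & vchain m zw.1 (rem k J)
  zw.2]].
have mB : measurable B.
  apply: measurable_bool_set.
  apply: measurable_and; first exact: measurable_fun_ltr.
  apply: measurable_and; first exact: measurable_fun_ltr.
  apply: (@measurable_chain_comp _ S snd) => // j jJ.
  by apply: measurableT_comp measurable_snd; exact: measurable_rv_sigma_rv.
have kN : k \notin rem k J by rewrite mem_rem_uniq// inE eqxx.
rewrite -[LHS]/(P [set w | B (V k w, w)]) (indep_fubini V_indep kN mB).
transitivity (\int[distribution P (V k)]_(z in `]x, (2 * x + s)%R[)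
    (hsum m (H (size J).-1 z))%:E)%E.
  rewrite [RHS]integral_mkcond; apply: eq_integral => z _.
  rewrite patchE mem_setE in_itv/=; case: ifP => zx.
    rewrite -ih; last by case/andP : zx; lra.
    by congr (P _); apply/seteqP; split => w; rewrite /B /= andbA zx.
  by rewrite (_ : [set w | _] = set0) ?measure0//; apply/seteqP; split => w //;
    rewrite /B/= andbA zx.
have mD : measurable (`]x, (2 * x + s)[%classic : set R) by exact: measurable_itv.
have [_ ->] : has_integral (distribution P (V k)) (`]x, (2 * x + s)[)
    (fun z => hsum m (H (size J).-1 z))
    (hsum m (fun j => hsum m0 (fun l =>
     (trpow (size J) (A l - (2 ^+ j - 1) * s - 2 ^+ j * x)
     - trpow (size J) (A l - (2 ^+ j - 1) * s - 2 ^+ j * (2 * x + s))) / ((size J)%:R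
       * 2 ^+ j)))).
  apply: (has_integral_hsum mD) => j; apply: (has_integral_hsum mD) => l.
  have -> : (fun z => trpow (size J).-1 (A l - 2 ^+ j * z - (2 ^+ j - 1) * s)) =
      (fun z => trpow (size J).-1 (A l - (2 ^+ j - 1) * s - 2 ^+ j * z)).
    by apply/funext => z; congr trpow; ring.
  apply: ge0_has_integral => //.
  - by apply: measurable_funTS; exact: measurable_trpow.
  - by move=> z; exact: trpow_ge0.
  - rewrite -{1 2}(prednK n0); rewrite integral_uniform_trpow ?prednK//.
      by move: (x) (s) x0 s_ge0 => y c; lra.
    by rewrite lerBlDr (le_trans (A_le1 l))// lerDl mulr_ge0// subr_ge0.
rewrite hsumS -hsumZ; congr EFin; apply: eq_hsum => j.
rewrite hdiffE /H -hsumB [RHS]mulrCA [RHS]mulrC -hsumZ.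
have nN : (size J)%:R != 0 :> R by rewrite pnatr_eq0 -lt0n.
have pN : (2 : R) ^+ j != 0 by rewrite expf_neq0.
apply: eq_hsum => l.
have -> : A l - 2 ^+ j * x - (2 ^+ j - 1) * s = A l - (2 ^+ j - 1) * s - 2 ^+ j * x.
  by ring.
have -> : A l - 2 ^+ j.+1 * x - (2 ^+ j.+1 - 1) * s =
    A l - (2 ^+ j - 1) * s - 2 ^+ j * (2 * x + s) by rewrite exprS; ring.
by field; apply/andP.
Qed.

(** The event splits according to the smallest point; the [size J] disjoint cases are equally
    likely, and their number cancels the factor of [prob_link]. With [base] abstract the lemma
    serves twice: for the right chain over [between], and for the left chain over the right one. *)
Lemma chain_prob m x J : 0 <= x -> uniq J -> (m + m0 <= size J)%N ->
  P [set w | chain (V ^~ w) s (base w) m x J] =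
  (hsum m (fun k => hsum m0 (fun l =>
     trpow (size J) (A l - 2 ^+ k * x - (2 ^+ k - 1) * s))))%:E.
Proof.
rewrite -/(H (size J) x).
elim: m x J => [|m ih] x J x0 uJ mJ.
  rewrite hsum0 base_prob//; congr EFin; apply: eq_hsum => l.
  by rewrite expr0 mul1r subrr mul0r subr0.
have n0 : (0 < size J)%N by apply: leq_trans mJ; rewrite addSn.
rewrite -/(H (size J) x).
have -> : [set w | chain (V ^~ w) s (base w) m.+1 x J] =
    \bigcup_(k in [set` J]) [set w | link m x J k w].
  apply/seteqP; split => w /=; first by move=> /hasP[k kJ kw]; exists k.
  by move=> [k kJ kw]; apply/hasP; exists k.
rewrite measure_fin_bigcup//; last exact: trivIset_link.
rewrite -fsbig_seq//.
rewrite (eq_big_seq (fun=> ((size J)%:R^-1 * hsum m.+1 (H (size J) x))%:E)); last first.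
  move=> k kJ; apply: prob_link => // z z0.
  rewrite ih ?rem_uniq//; first by rewrite size_rem.
  by rewrite size_rem// -ltnS prednK.
rewrite sumEFin big_const_seq count_predT iter_addr_0 -mulrnAl -mulr_natl.
by rewrite divff ?mul1r// pnatr_eq0 -lt0n.
Qed.

End chain_probability.

Section reflection.
Context {R : realType}.
Local Notation leb := (@lebesgue_measure R).

Let reflect (x : measurableTypeR R) : measurableTypeR R := 1 - x.

Let measurable_reflect : measurable_fun setT reflect.
Proof. by apply: measurable_funB; [exact: measurable_cst|exact: measurable_id]. Qed.

Let lebesgue_reflect (A : set (measurableTypeR R)) : measurable A ->
  leb (reflect @^-1` A) = leb A.
Proof.
move=> mA; pose nu : {measure set (measurableTypeR R) -> \bar R} :=
  pushforward leb reflect.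
apply/esym; rewrite -[RHS]/(nu measurable_reflect A);
  apply: lebesgue_measure_unique => // _ [[a b]] _ <-.
rewrite -[RHS]/(leb (reflect @^-1` _)).
have -> : reflect @^-1` [set` `]a, b]] = `[1 - b, 1 - a[%classic.
  by apply/seteqP; split => x; rewrite /reflect /= !in_itv/= => /andP[? ?];
    apply/andP; split; lra.
rewrite /= !lebesgue_measure_itv/= !lte_fin ltrD2l ltrN2.
by case: ifP => // _; rewrite -!EFinB; congr EFin; ring.
Qed.

Lemma uniform_probE (B : set (measurableTypeR R)) : measurable B ->
  uniform_prob (@ltr01 R) B = leb (B `&` `[0, 1]%classic).
Proof.
move=> mB; have mI : measurable (B `&` `[0, 1]%classic) by exact: measurableI.
rewrite /uniform_prob integral_uniform_pdf -[RHS]mul1e -integral_cst//.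
apply: eq_integral => x; rewrite inE => -[_]; rewrite /= in_itv/= /uniform_pdf => ->.
by rewrite subr0 invr1.
Qed.

Lemma uniform_prob_reflect (A : set R) : measurable A ->
  uniform_prob (@ltr01 R) ((fun x => 1 - x) @^-1` A) = uniform_prob (@ltr01 R) A.
Proof.
move=> mA.
have mR : measurable (reflect @^-1` A).
  by rewrite -[X in measurable X]setTI; exact: measurable_reflect.
rewrite (uniform_probE mR) (uniform_probE mA) -[RHS]lebesgue_reflect;
  last exact: measurableI.
congr (leb _); apply/seteqP; split => x; rewrite /reflect /= !in_itv/= => -[Ax
  /andP[? ?]].
  by split => //; apply/andP; split; lra.
by split => //; apply/andP; split; lra.
Qed.

End reflection.

Section two_sided.
Context d (T : measurableType d) (R : realType) (P : probability T R).
Context (I : choiceType) (U : I -> {RV P >-> R}) (s : R).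
Hypothesis U_indep : mutually_independent U.
Hypothesis U_unif : forall k, has_law (U k) (uniform_prob (@ltr01 R)).
Hypothesis s_ge0 : 0 <= s.
Implicit Types (J : seq I) (x y : R).

Let measurable_reflect_rv k : measurable_fun [set: T] (fun w => 1 - U k w).
Proof. by apply: measurable_funB => //; exact: measurable_funPT. Qed.

Let reflect_rv k : {RV P >-> R} := mk_rv P (measurable_reflect_rv k).

Let reflect_unif k : has_law (reflect_rv k) (uniform_prob (@ltr01 R)).
Proof.
move=> A mA; rewrite -uniform_prob_reflect// -(U_unif k)//.
rewrite -[X in measurable X]setTI; apply: measurable_funB => //; exact: measurable_id.
Qed.

Let reflect_indep : mutually_independent reflect_rv.
Proof.
move=> J A mA; apply: (U_indep J (A := fun i => (fun x => 1 - x) @^-1` A i)) => i.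
rewrite -[X in measurable X]setTI; apply: measurable_funB => //; exact: measurable_id.
Qed.

(** The right chain is the base of the left one and sees only the indices that the left one has not
    removed, hence the condition [m + m' <= size J] in [two_sided_prob]. *)
Definition two_sided (u : I -> R) m m' x y J : bool :=
  chain u s (fun x => chain (fun k => 1 - u k) s (between u x) m' y) m x J.

Let measurable_two_sided_base m' d' (S : measurableType d') (phi : S -> T)
    (f g : S -> R) J :
  (forall k, k \in J -> measurable_fun [set: S] (U k \o phi)) ->
  measurable_fun [set: S] f -> measurable_fun [set: S] g ->
  measurable_fun [set: S] (fun z => chain (fun k => 1 - U k (phi z)) s
    (between (U ^~ (phi z)) (f z)) m' (g z) J).
Proof.
move=> mU mf mg.
apply: (@measurable_chain _ _ _ _ (fun k z => 1 - U k (phi z)) _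
  (fun z => between (U ^~ (phi z)) (f z))) => // [k kJ|h K KJ mh].
  by apply: measurable_funB => //; exact: mU.
by apply: (@measurable_between _ _ _ _ (fun k z => U k (phi z))) => // k /KJ; exact: mU.
Qed.

Lemma measurable_two_sided m m' x y J :
  measurable [set w | two_sided (U ^~ w) m m' x y J].
Proof.
apply: measurable_bool_set; apply: measurable_chain => // f K KJ mf.
by apply: (@measurable_two_sided_base m' _ T id f (cst y) K).
Qed.

Let prob_between x y J : 0 <= x -> 0 <= y -> uniq J ->
  P [set w | between (U ^~ w) x y J] = (trpow (size J) (1 - x - y))%:E.
Proof.
move=> x0 y0 uJ; rewrite /trpow.
have xy : (x + y < 1) = (0 < 1 - x - y) by apply/idP/idP; lra.
case: ifPn => xy1; last first.
  rewrite (_ : [set w | _] = set0) ?measure0//.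
  by apply/seteqP; split => w //; rewrite /between/= xy (negbTE xy1).
pose B : set R := `]x, (1 - y)[%classic.
have mB : measurable B by exact: measurable_itv.
have PB k : P (U k @^-1` B) = (1 - x - y)%:E.
  rewrite -[LHS]/(distribution P (U k) B) U_unif// uniform_probE//.
  rewrite setIidl; last by move=> z; rewrite /B /= !in_itv/= => /andP[? ?];
    apply/andP; split; lra.
  by rewrite /B lebesgue_measure_itv/= lte_fin ifT -?EFinB; [congr EFin; ring|lra].
pose F := [fset i | i in J]%fset.
have := U_indep F (fun=> mB).
rewrite (eq_bigr (fun=> (1 - x - y)%:E)) => [|k _]; last exact: PB.
rewrite prodEFin big_const_seq count_predT iter_mulr_1.
have -> : size F = size J by rewrite -[LHS]/#|` F| card_fseq undup_id.
move=> <-; congr (P _); apply/seteqP; split => w /=.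
  move=> /andP[_ /allP UJ] k /=; rewrite in_fset => kJ.
  by rewrite /B /= in_itv/= UJ.
move=> UJ; rewrite /between xy xy1 /=; apply/allP => k kJ.
have := UJ k; rewrite /= in_fset => /(_ kJ).
by rewrite /B /= in_itv/=.
Qed.

(** [chain_prob] is used inside on the variables [1 - U k], uniform by reflection, with [m0 = 0],
    and outside on [U k] with the inner chain as base and [m0 = m']; the shifts [A l] record the
    inner result. *)
Lemma two_sided_prob m m' x y J : 0 <= x -> 0 <= y -> uniq J ->
  (m + m' <= size J)%N ->
  P [set w | two_sided (U ^~ w) m m' x y J] =
  (hsum m (fun k => hsum m' (fun l => trpow (size J)
     (1 - 2 ^+ l * y - (2 ^+ l - 1) * s - 2 ^+ k * x - (2 ^+ k - 1) * s))))%:E.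
Proof.
move=> x0 y0 uJ mJ.
have pow2_ge1 := @exp2_ge1 R.
apply: (@chain_prob _ _ _ _ _ U s
  (fun w x => chain (fun k => 1 - U k w) s (between (U ^~ w) x) m' y) m'
  (fun l => 1 - 2 ^+ l * y - (2 ^+ l - 1) * s)) => //.
- by move=> w z K /chain_between/andP[_ /allP UK] k /UK /andP[].
- move=> d' S phi f K mU mf.
  by apply: measurable_two_sided_base => //; exact: measurable_cst.
- move=> l; rewrite -addrA -opprD gerBl.
  by rewrite addr_ge0 ?mulr_ge0 ?exprn_ge0 ?subr_ge0.
move=> z K z0 uK mK.
rewrite (@chain_prob _ _ _ _ _ reflect_rv s (fun w y => between (U ^~ w) z y) 0
  (fun=> 1 - z))//.
- congr EFin; apply: eq_hsum => l; rewrite hsum0; congr trpow; ring.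
- by move=> w x' K' /andP[_ /allP UK] k /UK /andP[? ?] /=; lra.
- move=> d' S phi f K' mU mf.
  apply: (@measurable_between _ _ _ _ (fun k z => U k (phi z))) => // k kK'.
  have := measurable_funB (measurable_cst (1 : R)) (mU _ kK').
  apply: eq_measurable_fun => v _ /=; ring.
- by move=> _; lra.
- by move=> x' K' x0' uK' _; rewrite prob_between// hsum0.
- by rewrite addn0.
Qed.

End two_sided.

(** * Order statistics and travel time *)

Section sorted_chain.
Context {R : realType} {I : eqType}.
Implicit Types (v u : I -> R) (base : R -> seq I -> bool) (J K : seq I) (x y s : R).

Lemma perm_chain v s base m x J K :
  (forall y J' K', perm_eq J' K' -> base y J' = base y K') ->
  perm_eq J K -> chain v s base m x J = chain v s base m x K.
Proof.
move=> baseP; elim: m x J K => [|m ih] x J K JK /=; first exact: baseP.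
rewrite (perm_has _ JK); apply: eq_in_has => k kK.
congr [&& _, _ & _]; apply: ih.
have kJ : k \in J by rewrite (perm_mem JK).
rewrite -(perm_cons k); apply: (perm_trans _ (perm_to_rem kK)).
by rewrite perm_sym; apply: (perm_trans _ (perm_to_rem kJ)); rewrite perm_sym.
Qed.

(** On a sorted list the choice hidden in [has] must be the head: any other choice leaves the head
    among the remaining points, which [chain_gt] places above the chosen one. *)
Lemma chain_sorted v s base m x J :
  (forall y K, base y K -> {in K, forall k, y < v k}) ->
  sorted <%R (x :: map v J) -> (m <= size J)%N ->
  chain v s base m x J <->
  (forall i, (i < m)%N ->
    nth 0 (x :: map v J) i.+1 < 2 * nth 0 (x :: map v J) i + s) /\
  base (nth 0 (x :: map v J) m) (drop m J).
Proof.
move=> base_gt; elim: m x J => [|m ih] x J.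
  by move=> _ _; rewrite drop0; split => [//|[]].
case: J => [//|k J] xJ mJ; have [xk kJ] : x < v k /\ path <%R (v k) (map v J) by
  move: xJ => /= /andP[].
have E : chain v s base m.+1 x (k :: J) = (v k < 2 * x + s) && chain v s base m (v k) J.
  rewrite /= eqxx xk /=; case: (_ && _) / idP => //= kN.
  apply/negbTE/hasPn => j jJ; apply/negP => /and3P[_ _ /(chain_gt base_gt) jgt].
  have vkj : v k < v j.
    move: kJ; rewrite path_sortedE; last exact: lt_trans.
    by move=> /andP[/allP + _]; apply; exact: map_f.
  have kj : k != j by apply: contraTneq vkj => ->; rewrite ltxx.
  have := jgt k; rewrite (negbTE kj) inE eqxx => /(_ isT) vjk.
  by have := lt_trans vjk vkj; rewrite ltxx.
rewrite E; split.
  move=> /andP[k2 /ih[]// h1 h2]; split => // -[|i]; first by [].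
  by rewrite ltnS => /h1.
move=> [h1 h2]; apply/andP; split; first exact: (h1 0%N).
by apply/ih => //; split => // i im; exact: (h1 i.+1).
Qed.

End sorted_chain.

Section order_statistics.
Context {R : realType} (n : nat) (u : 'I_n -> R) (s : R).
Definition low_gaps m := forall i, (i < m)%N ->
  order_stat u i.+1 < 2 * order_stat u i + s.

Definition high_gaps m := forall i, (i < m)%N ->
  1 - order_stat u (n - i) < 2 * (1 - order_stat u (n.+1 - i)) + s.

Lemma travel_time_gt : (0 < n)%N ->
  (1 - s < travel_time u) <-> low_gaps n /\ high_gaps n.
Proof.
move=> n0; rewrite /travel_time ltrD2l ltrN2 gt_max.
have bigmaxE (F : nat -> R) :
    (\big[Num.max/F 1%N]_(1 <= j < n.+1) F j < s) <-> (forall i, (i < n)%N -> F i.+1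
      < s).
  rewrite big_add1 big_mkord; split.
    by move=> /bigmax_ltP[_ h] i i_n; exact: (h (Ordinal i_n)).
  move=> h; apply/bigmax_ltP; split; first exact: h.
  by move=> i _; exact: h.
have lowE : low_gaps n <-> forall i, (i < n)%N ->
    spacing u i.+1 - order_stat u i.+1.-1 < s.
  by split => h i i_n; have := h i i_n; rewrite /spacing /=; lra.
have highE : high_gaps n <-> forall i, (i < n)%N ->
    spacing u (n + 2 - i.+1) - (1 - order_stat u (n + 2 - i.+1)) < s.
  have e1 i : (n + 2 - i.+1 = n.+1 - i)%N by lia.
  have e2 i : ((n.+1 - i).-1 = n - i)%N by lia.
  by split => h i i_n; have := h i i_n; rewrite /spacing e1 e2; lra.
rewrite lowE highE -(bigmaxE (fun j => spacing u j - order_stat u j.-1)).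
rewrite -(bigmaxE (fun j => spacing u (n + 2 - j) - (1 - order_stat u (n + 2 - j)))).
by split => [/andP|/andP].
Qed.

Hypothesis u_inj : injective u.
Hypothesis u01 : forall k, 0 < u k < 1.

Let J := sort (relpre u <=%R) (enum 'I_n).
Let w := 0 :: rcons (map u J) 1.

Let order_statE i : order_stat u i = nth 0 w i.
Proof. by rewrite /order_stat /w /J sort_map. Qed.

Let size_J : size J = n.
Proof. by rewrite size_sort size_enum_ord. Qed.

Let size_w : size w = n.+2.
Proof. by rewrite /= size_rcons size_map size_J. Qed.

Let sorted_w : sorted <%R w.
Proof.
have sJ : sorted <%R (map u J).
  rewrite lt_sorted_uniq_le map_inj_uniq// sort_uniq enum_uniq/=.
  by rewrite /J -sort_map sort_le_sorted.
rewrite /w /= rcons_path; apply/andP; split.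
  rewrite path_sortedE; last exact: lt_trans.
  by rewrite sJ andbT; apply/allP => _ /mapP[k _ ->]; case/andP: (u01 k).
have := mem_last 0 (map u J); rewrite inE => /predU1P[->|/mapP[k _ ->]];
  first exact: ltr01.
by case/andP: (u01 k).
Qed.

Let w_lt i j : (i < j)%N -> (j < n.+2)%N -> nth 0 w i < nth 0 w j.
Proof.
move=> ij jn; apply: (sorted_ltn_nth lt_trans 0 sorted_w) => //; rewrite inE size_w//.
exact: ltn_trans jn.
Qed.

(** The left chain consumes the m lowest points in order and the right chain the m' highest. As
    [m + m' <= n] they do not overlap, and [between] follows from the strict ordering. *)
Lemma two_sided_order_stat m m' : (m + m' <= n)%N ->
  two_sided s u m m' 0 0 (enum 'I_n) <-> low_gaps m /\ high_gaps m'.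
Proof.
move=> mn; rewrite /two_sided.
have betweenP K K' x y : perm_eq K K' -> between u x y K = between u x y K'.
  by move=> KK'; rewrite /between (perm_all _ KK').
have chain_betweenP K K' x : perm_eq K K' ->
    chain (fun k => 1 - u k) s (between u x) m' 0 K =
    chain (fun k => 1 - u k) s (between u x) m' 0 K'.
  by move=> KK'; apply: perm_chain KK' => y K1 K2; exact: betweenP.
have nthJ i : (i <= n)%N -> nth 0 (0 :: map u J) i = order_stat u i.
  move=> i_n; rewrite order_statE /w; case: i i_n => [//|i] i_n /=.
  by rewrite nth_rcons size_map size_J i_n.
rewrite (@perm_chain _ _ _ _ _ _ _ _ J); last 2 first.
- by move=> x K1 K2; exact: chain_betweenP.
- by rewrite perm_sym perm_sort.
have mJ : (m <= size J)%N by rewrite size_J; lia.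
rewrite chain_sorted//; last 2 first.
- by move=> x K /chain_between /andP[_ /allP uK] k /uK /andP[].
- have := sorted_w; rewrite /w /= rcons_path => /andP[].
  by [].
rewrite nthJ; last lia.
have -> : (forall i, (i < m)%N -> nth 0 (0 :: map u J) i.+1 < 2 * nth 0 (0 :: map u
  J) i + s)
    <-> low_gaps m.
  by split => h i im; have := h i im; rewrite !nthJ//; lia.
suff -> : chain (fun k => 1 - u k) s (between u (order_stat u m)) m' 0 (drop m J) <->
    high_gaps m' by [].
rewrite (@chain_betweenP _ (rev (drop m J))); last by rewrite perm_sym perm_rev.
have wE : 0 :: map (fun k => 1 - u k) (rev (drop m J)) = map (fun x => 1 - x) (rev
  (drop m.+1 w)).
  rewrite /w /= drop_rcons ?size_map// rev_rcons /= subrr.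
  by rewrite -map_drop -map_rev -map_comp.
have nthR i : (i <= n - m)%N ->
    nth 0 (map (fun x => 1 - x) (rev (drop m.+1 w))) i = 1 - order_stat u (n.+1 - i).
  move=> im; have sz : (i < size (rev (drop m.+1 w)))%N by rewrite size_rev size_drop
    size_w; lia.
  rewrite (nth_map 0)// nth_rev; last by rewrite -size_rev.
  rewrite nth_drop size_drop size_w order_statE; congr (1 - nth _ _ _); lia.
rewrite chain_sorted; last 3 first.
- by move=> y K /andP[_ /allP uK] k /uK /andP[? ?]; lra.
- rewrite wE sorted_map rev_sorted; apply: sub_sorted (drop_sorted m.+1 sorted_w).
  by move=> a b /= ab; lra.
- by rewrite size_rev size_drop size_J; lia.
rewrite wE.
have -> : (forall i, (i < m')%N -> nth 0 (map (fun x => 1 - x) (rev (drop m.+1 w)))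
  i.+1 <
    2 * nth 0 (map (fun x => 1 - x) (rev (drop m.+1 w))) i + s) <-> high_gaps m'.
  by split => h i im; have := h i im; rewrite !nthR ?subSS//; lia.
split => [[]//|h]; split => //.
rewrite nthR; last lia.
apply/andP; split.
  rewrite addrCA gtrDl subr_lt0 !order_statE; apply: w_lt; lia.
apply/allP => k; rewrite drop_rev mem_rev => /(nthP k)[i].
rewrite size_take size_drop size_J => iK <-.
have im : (i < n - m - m')%N by move: iK; case: ifP; lia.
rewrite nth_take// nth_drop.
have -> : u (nth k J (m + i)) = order_stat u (m + i).+1.
  by rewrite -nthJ ?(nth_map k)//= ?(nth_map k) ?size_J//; lia.
rewrite opprB addrC subrK !order_statE.
by apply/andP; split; apply: w_lt; lia.
Qed.

End order_statistics.

(** A chain that uses up all of J picks its points in strictly increasing order. This is how ties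
    are shown to be negligible. *)
Lemma chain_uniq {R : realType} {I : eqType} (v : I -> R) (s x : R)
    (base : R -> seq I -> bool) (J : seq I) :
  (forall y K, base y K -> {in K, forall k, y < v k}) -> uniq J ->
  chain v s base (size J) x J -> {in J &, injective v}.
Proof.
move=> base_gt; move: {-2}(size J) (erefl (size J)) => m.
elim: m x J => [|m ih] x J; first by move=> /esym/size0nil ->.
move=> sJ uJ /= /hasP[k kJ /and3P[_ _ ck]].
have sr : m = size (rem k J) by rewrite size_rem// -sJ.
have inj := ih _ _ sr (rem_uniq _ uJ) ck.
have kgt := chain_gt base_gt ck.
have inr i : i \in J -> i != k -> i \in rem k J.
  by rewrite (perm_mem (perm_to_rem kJ)) inE => /orP[->|//].
move=> i j iJ jJ vij; have [ik|ik] := eqVneq i k; have [jk|jk] := eqVneq j k.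
- by rewrite ik jk.
- by have := kgt _ (inr _ jJ jk); rewrite -vij ik ltxx.
- by have := kgt _ (inr _ iJ ik); rewrite vij jk ltxx.
- by apply: inj => //; exact: inr.
Qed.

(** * Bounds on the law of the travel time *)

Section gaps.
Context d (T : measurableType d) (R : realType) (P : probability T R).
Context (n : nat) (U : 'I_n -> {RV P >-> R}).
Hypothesis U_indep : mutually_independent U.
Hypothesis U_unif : forall k, has_law (U k) (uniform_prob (@ltr01 R)).
Implicit Types (s : R) (m : nat).

Definition gaps_value m m' s : R :=
  hsum m (fun k => hsum m' (fun l => trpow n (1 - (2 ^+ l - 1) * s - (2 ^+ k - 1) *
    s))).

Let prob_enum s m m' : 0 <= s -> (m + m' <= n)%N ->
  P [set w | two_sided s (U ^~ w) m m' 0 0 (enum 'I_n)] = (gaps_value m m' s)%:E.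
Proof.
move=> s0 mn; rewrite two_sided_prob ?enum_uniq ?size_enum_ord//.
by congr EFin; apply: eq_hsum => k; apply: eq_hsum => l; rewrite !mulr0 !subr0.
Qed.

(* With s = 1 the successive constraints of two_sided hold automatically, so
   that they only express that the points are distinct and in ]0, 1[. *)
Let spread : set T := [set w | two_sided 1 (U ^~ w) 0 n 0 0 (enum 'I_n)].

Let measurable_spread : measurable spread.
Proof. exact: measurable_two_sided. Qed.

(** For s = 1 the argument of the truncated power is [2 - 2 ^ l]: it is 1 at l = 0 and nonpositive
    afterwards, so [hsum_delta] gives probability 1. *)
Let spread_ae : P (~` spread) = 0%E.
Proof.
rewrite probability_setC// prob_enum// /gaps_value hsum0.
rewrite (@eq_hsum _ _ _ (fun l => (l == 0%N)%:R)) ?hsum_delta ?subee// => l.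
rewrite expr0 subrr mul0r subr0 mulr1 /trpow; case: l => [|l].
  by rewrite expr0 subrr subr0 ltr01 expr1n.
have := @exp2_ge1 R l.
by rewrite exprS => l1; rewrite ifF//; apply/negbTE; rewrite -leNgt; lra.
Qed.

Let spreadP w : spread w -> injective (U ^~ w) /\ forall k, 0 < U k w < 1.
Proof.
move=> sw; split; last first.
  move=> k; have /chain_between/andP[_ /allP/(_ k)] := sw.
  by rewrite mem_enum subr0; exact.
have inj : {in enum 'I_n &, injective (fun k => 1 - U k w)}.
  apply: (@chain_uniq _ _ _ 1 0 (between (U ^~ w) 0)); last first.
  - by rewrite size_enum_ord; exact: sw.
  - exact: enum_uniq.
  - by move=> y K /andP[_ /allP UK] k /UK /andP[? ?]; lra.
move=> i j ij; apply: inj; rewrite ?mem_enum//.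
by have -> : U i w = U j w by exact: ij.
Qed.

Let low s m := [set w | low_gaps (U ^~ w) s m].
Let high s m := [set w | high_gaps (U ^~ w) s m].

Let mos i : measurable_fun [set: T] (fun w => order_stat (U ^~ w) i).
Proof. by apply: measurable_order_stat => k; exact: measurable_funPT. Qed.

Let measurable_low s m : measurable (low s m).
Proof.
rewrite (_ : low s m = \bigcap_(i in `I_m)
   [set w | order_stat (U ^~ w) i.+1 < 2 * order_stat (U ^~ w) i + s]); last by [].
apply: bigcap_measurableType => i _; apply: measurable_bool_set.
by apply: measurable_fun_ltr => //; apply: measurable_funD => //;
  apply: measurable_funM.
Qed.

Let measurable_high s m : measurable (high s m).
Proof.
rewrite (_ : high s m = \bigcap_(i in `I_m)
   [set w | 1 - order_stat (U ^~ w) (n - i) <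
     2 * (1 - order_stat (U ^~ w) (n.+1 - i)) + s]); last by [].
apply: bigcap_measurableType => i _; apply: measurable_bool_set.
apply: measurable_fun_ltr => //; first exact: measurable_funB.
by apply: measurable_funD => //; apply: measurable_funM => //; exact: measurable_funB.
Qed.

Let gaps_prob s m m' : 0 <= s -> (m + m' <= n)%N ->
  P (low s m `&` high s m') = (gaps_value m m' s)%:E.
Proof.
move=> s0 mn; rewrite -(prob_enum s0 mn).
have mE : measurable [set w | two_sided s (U ^~ w) m m' 0 0 (enum 'I_n)].
  exact: measurable_two_sided.
have mLH : measurable (low s m `&` high s m') by exact: measurableI.
rewrite -(probabilityI_full mE measurable_spread spread_ae).
rewrite -(probabilityI_full mLH measurable_spread spread_ae).
congr (P _); apply/seteqP; split => w /= [Ew sw]; split => //;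
  have [iw w01] := spreadP sw.
  exact/(two_sided_order_stat s iw w01 mn).
exact/(two_sided_order_stat s iw w01 mn).
Qed.

Let travel s := [set w | 1 - s < travel_time_rv U w].

Let prob_travel s : (0 < n)%N -> P (travel s) = P (low s n `&` high s n).
Proof.
move=> n0; congr (P _); apply/seteqP.
by split => w; move=> /(travel_time_gt (U ^~ w) s n0).
Qed.

Let low_mono s m m' : (m <= m')%N -> low s m' `<=` low s m.
Proof. by move=> mm' w h i im; apply: h; exact: leq_trans mm'. Qed.

Let high_mono s m m' : (m <= m')%N -> high s m' `<=` high s m.
Proof. by move=> mm' w h i im; apply: h; exact: leq_trans mm'. Qed.

Lemma travel_time_prob_le s m m' : (0 < n)%N -> 0 <= s -> (m + m' <= n)%N ->
  (P [set w | (1 - s < travel_time_rv U w)%R] <= (gaps_value m m' s)%:E)%E.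
Proof.
move=> n0 s0 mn; rewrite -/(travel s) prob_travel// -gaps_prob//.
apply: le_measure; rewrite ?inE; [exact: measurableI|exact: measurableI|].
by apply: setISS; [apply: low_mono|apply: high_mono]; lia.
Qed.

(** The inequalities from m to n are added one side at a time: each side alone obeys the exact
    formula at both lengths m and n, and a union bound subtracts the two one-sided losses. *)
Lemma travel_time_prob_ge s m : (0 < n)%N -> 0 <= s -> (m + m <= n)%N ->
  ((gaps_value m m s - (gaps_value m 0 s - gaps_value n 0 s)
     - (gaps_value 0 m s - gaps_value 0 n s))%:E
   <= P [set w | (1 - s < travel_time_rv U w)%R])%E.
Proof.
move=> n0 s0 mn; rewrite -/(travel s) prob_travel//.
have m_n : (m <= n)%N by lia.
have lowE k : (k <= n)%N -> P (low s k) = (gaps_value k 0 s)%:E.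
  by move=> kn; rewrite -gaps_prob ?addn0// (_ : high s 0 = setT) ?setIT//;
    apply/seteqP.
have highE k : (k <= n)%N -> P (high s k) = (gaps_value 0 k s)%:E.
  by move=> kn; rewrite -gaps_prob// (_ : low s 0 = setT) ?setTI//; apply/seteqP.
have PD A B : measurable A -> measurable B -> B `<=` A ->
    P (A `\` B) = (P A - P B)%E.
  move=> mA mB BA; rewrite measureD//; first by rewrite setIidr.
  by rewrite -ge0_fin_numE// fin_num_measure.
have PA : P (low s m `\` low s n) = (gaps_value m 0 s - gaps_value n 0 s)%:E.
  by rewrite PD ?lowE//; exact: low_mono.
have PB : P (high s m `\` high s n) = (gaps_value 0 m s - gaps_value 0 n s)%:E.
  by rewrite PD ?highE//; exact: high_mono.
rewrite EFinB -PB EFinB -PA.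
rewrite -(gaps_prob s0 mn); set LH := low s n `&` high s n.
have mLH : measurable LH by exact: measurableI.
have mLD : measurable (low s m `\` low s n) by exact: measurableD.
have mHD : measurable (high s m `\` high s n) by exact: measurableD.
have sub : low s m `&` high s m `<=`
    LH `|` ((low s m `\` low s n) `|` (high s m `\` high s n)).
  move=> w [lw hw]; have [ln|ln] := pselect (low s n w); last by right; left.
  by have [hn|hn] := pselect (high s n w); [left|right; right].
rewrite leeBlDr ?fin_num_measure// leeBlDr ?fin_num_measure// -addeA.
apply: (le_trans (le_measure _ _ _ sub)); rewrite ?inE.
- exact: measurableI.
- by apply: measurableU => //; exact: measurableU.
have PU A B : measurable A -> measurable B -> (P (A `|` B) <= P A + P B)%E.
  by move=> mA mB; exact: measureU2.
apply: (le_trans (PU _ _ mLH (measurableU _ _ mLD mHD))).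
by rewrite leeD2l// [leRHS]addeC PU.
Qed.

End gaps.

(** * Limit of the travel time *)

Section gap_limit.
Context {R : realType}.

Lemma cvg_trpow (c : R) : 0 <= c ->
  trpow n (1 - c / n.+1%:R) @[n --> \oo] --> expR (- c).
Proof.
move=> c0.
have h0 : harmonic @ \oo --> (0 : R) := @cvg_harmonic R.
have expR_cvg (f : nat -> R) : f @ \oo --> - c -> expR (f n) @[n --> \oo] --> expR (-
  c).
  by move=> fc; apply: continuous_cvg => //; exact: continuous_expR.
have h1 : (1 - harmonic n : R) @[n --> \oo] --> (1 : R).
  by rewrite -[X in _ --> X]subr0; apply: cvgB => //; exact: cvg_cst.
have ch : (1 - c * harmonic n : R) @[n --> \oo] --> (1 : R).
  rewrite -[X in _ --> X]subr0 -(mulr0 c); apply: cvgB; first exact: cvg_cst.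
  exact: cvgMr.
have c1 : c * (1 - harmonic n) @[n --> \oo] --> c.
  by rewrite -[X in _ --> X]mulr1; exact: cvgMr.
(* With [y = c / (n + 1)], the squeeze comes from [1 / (1 - y) = 1 + y / (1 - y) <= exp (y / (1 -
   y))] below and [1 - y <= exp (- y)] above, raised to the power n. *)
have lo : expR (- (c * (1 - harmonic n) / (1 - c * harmonic n))) @[n --> \oo] -->
  expR (- c).
  apply: (expR_cvg (fun n => - (c * (1 - harmonic n) / (1 - c * harmonic n)))).
  apply: cvgN; rewrite -[X in _ --> X]mulr1 -[X in _ * X]invr1.
  by apply: cvgM => //; apply: cvgV => //; exact: oner_neq0.
have up : expR (- (c * (1 - harmonic n))) @[n --> \oo] --> expR (- c).
  by apply: (expR_cvg (fun n => - (c * (1 - harmonic n)))); exact: cvgN.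
apply: squeeze_cvgr lo up; near=> n.
have y1 : 0 < 1 - c * harmonic n.
  by near: n; apply: (cvgr_gt _ ch); exact: ltr01.
have nE : n%:R * harmonic n = 1 - harmonic n :> R.
  by rewrite /harmonic /= -natr1; field; rewrite natr1 pnatr_eq0.
rewrite /trpow -[c / _]/(c * harmonic n) y1; apply/andP; split.
  have -> : - (c * (1 - harmonic n) / (1 - c * harmonic n)) =
      n%:R * (- (c * harmonic n / (1 - c * harmonic n))).
    by rewrite -nE; ring.
  rewrite expRM_natl lerXn2r ?nnegrE ?expR_ge0 ?(ltW y1)//.
  rewrite expRN invf_ple ?posrE ?expR_gt0//.
  apply: le_trans (expR_ge1Dx _).
  by rewrite le_eqVlt; apply/orP; left; apply/eqP; field; rewrite gt_eqF.
have -> : - (c * (1 - harmonic n)) = n%:R * (- (c * harmonic n)) by rewrite -nE; ring.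
rewrite expRM_natl lerXn2r ?nnegrE ?expR_ge0 ?(ltW y1)//.
exact: expR_ge1Dx.
Unshelve. all: by end_near. Qed.

(** The two sides become independent only here: the exponential of the sum of both costs factors,
    while the truncated power does not. *)
Lemma cvg_gaps_value m m' (t : R) : 0 <= t ->
  gaps_value n m m' (t / n.+1%:R) @[n --> \oo] -->
    hsum m (eweight t) * hsum m' (eweight t).
Proof.
move=> t0; rewrite mulrC -hsumZ; apply: cvg_hsum => k.
rewrite mulrC -hsumZ; apply: cvg_hsum => l.
rewrite /eweight -expRD.
have -> : - (2 ^+ k - 1) * t + - (2 ^+ l - 1) * t = - ((2 ^+ l - 1 + (2 ^+ k - 1)) * t).
  by ring.
have pow2_ge1 := @exp2_ge1 R.
rewrite (_ : (fun n => _) = fun n => trpow n (1 - (2 ^+ l - 1 + (2 ^+ k - 1)) * t /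
  n.+1%:R)).
  by apply: cvg_trpow; rewrite mulr_ge0// addr_ge0// subr_ge0.
by apply/funext => n; congr trpow; ring.
Qed.

(** Both terms are compared with [etail h], whence [48 = 2 * 24]. Only B enters, so h itself may
    depend on n. *)
Lemma hsum_cauchy m n (h : nat -> R) B : (m <= n)%N -> (forall k, `|h k| <= B) ->
  `|hsum m h - hsum n h| <= 48 * B * (3 / 4) ^+ m.
Proof.
move=> mn hB; have B0 : 0 <= B := le_trans (normr_ge0 _) (hB 0%N).
have h1 := hsum_etail m hB; have h2 := hsum_etail n hB.
have h3 : (3 / 4) ^+ n <= (3 / 4) ^+ m :> R by apply: ler_wiXn2l => //; lra.
rewrite (_ : hsum m h - hsum n h = (etail h - hsum n h) - (etail h - hsum m h));
  last by ring.
apply: (le_trans (ler_normB _ _)); apply: (le_trans (lerD h2 h1)).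
by nra.
Qed.

Lemma trpow_gap_le1 n (s : R) k l : 0 <= s ->
  `|trpow n (1 - (2 ^+ l - 1) * s - (2 ^+ k - 1) * s)| <= 1.
Proof.
move=> s0; rewrite ger0_norm ?trpow_ge0// trpow_le1// -addrA -opprD gerBl.
by rewrite addr_ge0// mulr_ge0// subr_ge0 exp2_ge1.
Qed.

Section travel_time_limit.
Context (d : nat -> measure_display) (T : forall n, measurableType (d n))
  (P : forall n, probability (T n) R) (U : forall n, 'I_n -> {RV (P n) >-> R}).
Hypothesis U_indep : forall n, mutually_independent (@U n).
Hypothesis U_unif : forall n (k : 'I_n), has_law (@U n k) (uniform_prob (@ltr01 R)).

Implicit Types t : R.

Let late t n : set (T n) := [set w | travel_time_rv (@U n) w > 1 - t / n.+1%:R].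
Arguments late : clear implicits.

Let measurable_late t n : measurable (late t n).
Proof. by apply: measurable_bool_set; exact: measurable_fun_ltr. Qed.

Let late_near t m n : (0 < n)%N -> 0 <= t -> (m + m <= n)%N ->
  `|fine (P n (late t n)) - gaps_value n m m (t / n.+1%:R)| <= 96 * (3 / 4) ^+ m.
Proof.
move=> n0 t0 mn; set s := t / _; have s0 : 0 <= s by rewrite divr_ge0.
have pE : P n (late t n) = (fine (P n (late t n)))%:E by rewrite fineK ?fin_num_measure.
have := travel_time_prob_le (@U_indep n) (@U_unif n) n0 s0 mn.
have := travel_time_prob_ge (@U_indep n) (@U_unif n) n0 s0 mn.
rewrite -/(late t n) pE !lee_fin.
have m_n : (m <= n)%N by lia.
(* One-sided values: the index of the absent side is frozen at 0, where its cost [2 ^ 0 - 1] is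
   zero. Each side contributes 48, hence the 96. *)
have := @hsum_cauchy m n (fun k => trpow n (1 - (2 ^+ 0 - 1) * s - (2 ^+ k - 1) * s))
  1 m_n
  (fun k => trpow_gap_le1 n k 0 s0).
have := @hsum_cauchy m n (fun l => trpow n (1 - (2 ^+ l - 1) * s - (2 ^+ 0 - 1) * s))
  1 m_n
  (fun l => trpow_gap_le1 n 0 l s0).
rewrite -/(gaps_value n m 0 s) -/(gaps_value n n 0 s).
rewrite -[hsum m _]/(gaps_value n 0 m s) -[hsum n _]/(gaps_value n 0 n s).
rewrite !ler_norml.
have : 0 <= (3 / 4 : R) ^+ m by rewrite exprn_ge0.
move: (gaps_value n m m s) (gaps_value n m 0 s) (gaps_value n n 0 s)
  (gaps_value n 0 m s) (gaps_value n 0 n s) (fine _) ((3 / 4) ^+ m) => g a b c e p q.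
by move=> /= ? /andP[? ?] /andP[? ?] ? ?; apply/andP; split; lra.
Qed.

Lemma cvg_late t : 0 <= t ->
  P n (late t n) @[n --> \oo] --> (limit_P t ^+ 2)%:E.
Proof.
move=> t0; rewrite (limit_PE t0).
suff : fine (P n (late t n)) @[n --> \oo] --> etail (eweight t) ^+ 2.
  move=> h; have -> : (fun n => P n (late t n)) = (fun n => (fine (P n (late t n)))%:E).
    by apply/funext => n; rewrite fineK ?fin_num_measure.
  by apply: cvg_EFin => //; exact: nearW.
have g2 : hsum m (eweight t) * hsum m (eweight t) @[m --> \oo] --> etail (eweight t)
  ^+ 2.
  have g1 := cvg_hsum_etail (fun k => eweight_le1 k t0).
  by rewrite expr2; exact: cvgM.
have q0 : 96 * (3 / 4) ^+ m @[m --> \oo] --> (0 : R).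
  rewrite -(mulr0 96); apply: cvgMr; apply: cvg_expr.
  by rewrite ger0_norm; lra.
apply/cvgrPdist_lt => e e0; have e3 : 0 < e / 3 by lra.
(* The length m is fixed first, by the error bound uniform in n and the limit of [hsum]; only then
   is n taken large, depending on m. *)
near \oo => m.
have qm : `|0 - 96 * (3 / 4) ^+ m| < e / 3 :> R.
  by near: m; move/cvgrPdist_lt : q0; exact.
have gm : `|etail (eweight t) ^+ 2 - hsum m (eweight t) * hsum m (eweight t)| < e / 3.
  by near: m; move/cvgrPdist_lt : g2; exact.
near=> n.
have gn : `|hsum m (eweight t) * hsum m (eweight t) - gaps_value n m m (t / n.+1%:R)|
  < e / 3.
  by near: n; have /cvgrPdist_lt := @cvg_gaps_value m m t t0; exact.
have n0 : (0 < n)%N by near: n; exists 1%N.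
have mn : (m + m <= n)%N by near: n; exists (m + m)%N.
have := late_near n0 t0 mn.
move: qm gm gn; rewrite sub0r normrN ger0_norm ?mulr_ge0 ?exprn_ge0//.
rewrite !ltr_norml !ler_norml.
move=> ? /andP[? ?] /andP[? ?] /andP[? ?]; apply/andP; split; lra.
Unshelve. all: by end_near. Qed.

End travel_time_limit.

End gap_limit.

Theorem theorem4p2 (R : realType)
  (d : nat -> measure_display) (Omega : forall n, measurableType (d n))
  (Prob : forall n, probability (Omega n) R)
  (U : forall n, 'I_n -> {RV (Prob n) >-> R})
  (d' : measure_display) (Omega' : measurableType d') (Q : probability Omega' R)
  (X X' : nat -> {RV Q >-> R})
  (U_indep : forall n, mutually_independent (@U n))
  (U_unif : forall n (k : 'I_n), has_law (U n k) (uniform_prob (@ltr01 R)))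
  (X_indep : mutually_independent (fun k : nat + nat =>
     match k with inl j => X j | inr j => X' j end))
  (X_exp : forall j, has_law (X j) (exponential_prob 1))
  (X'_exp : forall j, has_law (X' j) (exponential_prob 1)) :
  [/\ cvg_in_distribution (fun n => scaled_gap_rv (@U n)) (limit_rv X X'),
      forall t : R, 0 <= t ->
        Prob n [set w | travel_time_rv (@U n) w > 1 - t / n.+1%:R] @[n --> \oo]
          --> (limit_P t ^+ 2)%:E
    & forall t : R, 0 <= t -> cdf (limit_rv X X') t = (limit_P t ^+ 2)%:E].
Proof.
have lim_ge0 := cdf_limit_rv_ge0 X_indep X_exp X'_exp.
have lim_lt0 := cdf_limit_rv_lt0 X_indep X_exp X'_exp.
have late := cvg_late U_indep U_unif.
split => // t _.
have cdfE n : cdf (scaled_gap_rv (@U n)) t =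
    Prob n [set w | n.+1%:R * (1 - travel_time_rv (@U n) w) <= t].
  by congr (Prob n _); apply/seteqP; split => w; rewrite /= in_itv.
have lateE n r : [set w | travel_time_rv (@U n) w > 1 - r / n.+1%:R] =
    [set w | n.+1%:R * (1 - travel_time_rv (@U n) w) < r].
  have E (x : R) : (n.+1%:R * x < r) = (x < r / n.+1%:R).
    by rewrite ltr_pdivlMr ?ltr0n// mulrC.
  by apply/seteqP; split => w /=; rewrite E !ltrBlDr addrC.
have mlate n r : measurable [set w | n.+1%:R * (1 - travel_time_rv (@U n) w) < r].
  by rewrite -lateE; apply: measurable_bool_set; exact: measurable_fun_ltr.
have mcdf n r : measurable [set w | n.+1%:R * (1 - travel_time_rv (@U n) w) <= r].
  apply: measurable_bool_set; apply: measurable_fun_ler => //.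
  by apply: measurable_funM => //; exact: measurable_funB.
(* The distribution function has a non-strict inequality and the late event a strict one, so the
   former is caught between the late events at t and at any r > t. *)
have cdf_le n r : t < r -> (cdf (scaled_gap_rv (@U n)) t <=
    Prob n [set w | (travel_time_rv (@U n) w > 1 - r / n.+1%:R)%R])%E.
  move=> tr; rewrite cdfE lateE; apply: le_measure; rewrite ?inE//.
  by move=> w /= h; exact: le_lt_trans h tr.
have [t0|t0] := ltP t 0.
  (* At level 0 the first inequality already has probability 0: its value is [hsum 1] of a
     constant. *)
  rewrite lim_lt0//; apply: cvg_near_cst; exists 1%N => // n /= n0.
  apply/eqP; rewrite eq_le cdf_ge0 andbT; apply: (le_trans (cdf_le n _ t0)).
  rewrite mul0r.
  apply: (le_trans (@travel_time_prob_le _ _ _ _ n (@U n) (@U_indep n) (@U_unif n) 0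
    1 0 n0 _ _)) => //.
  rewrite lee_fin /gaps_value (@eq_hsum _ _ _ (fun=> trpow n 1)) ?hsum_cst// => k.
  by rewrite hsum0 !mulr0 !subr0.
rewrite lim_ge0//.
suff : fine (cdf (scaled_gap_rv (@U n)) t) @[n --> \oo] --> limit_P t ^+ 2.
  move=> h; rewrite (_ : (fun n => _) = (fun n => (fine (cdf (scaled_gap_rv (@U n))
    t))%:E)).
    by apply: cvg_EFin => //; exact: nearW.
  by apply/funext => n; rewrite fineK ?fin_num_measure.
apply/cvgrPdist_lt => e e0; have e2 : 0 < e / 2 by lra.
(* Right continuity of the limiting distribution function makes passing from t to r cost less than
   [e / 2]. *)
have [r [tr r0 rlim]] : exists r, [/\ t < r, 0 <= r & limit_P r ^+ 2 < limit_P t ^+ 2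
  + e / 2].
  have := @cdf_right_continuous _ _ _ _ (limit_rv X X') t.
  rewrite lim_ge0// => /fine_cvg rc.
  near t^'+ => r; have tr : t < r by near: r; exact: nbhs_right_gt.
  have r0 : 0 <= r := le_trans t0 (ltW tr).
  exists r; split => //.
  rewrite -[limit_P r ^+ 2]/(fine (limit_P r ^+ 2)%:E) -lim_ge0//.
  by near: r; apply: (cvgr_lt _ rc); rewrite ltrDl.
have c1 : fine (Prob n [set w | travel_time_rv (@U n) w > 1 - t / n.+1%:R]) @[n --> \oo]
    --> limit_P t ^+ 2.
  by apply: fine_cvg; exact: late.
have c2 : fine (Prob n [set w | travel_time_rv (@U n) w > 1 - r / n.+1%:R]) @[n --> \oo]
    --> limit_P r ^+ 2.
  by apply: fine_cvg; exact: late.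
near=> n.
have h1 : `|limit_P t ^+ 2 - fine (Prob n [set w | travel_time_rv (@U n) w > 1 - t /
  n.+1%:R])| < e / 2.
  by near: n; move/cvgrPdist_lt : c1; exact.
have h2 : `|limit_P r ^+ 2 - fine (Prob n [set w | travel_time_rv (@U n) w > 1 - r /
  n.+1%:R])| < e / 2.
  by near: n; move/cvgrPdist_lt : c2; exact.
have l1 : fine (Prob n [set w | travel_time_rv (@U n) w > 1 - t / n.+1%:R]) <=
    fine (cdf (scaled_gap_rv (@U n)) t).
  apply: fine_le; rewrite ?fin_num_measure//; first by rewrite lateE.
  by rewrite cdfE lateE; apply: le_measure; rewrite ?inE// => w /= /ltW.
have l2 : fine (cdf (scaled_gap_rv (@U n)) t) <=
    fine (Prob n [set w | travel_time_rv (@U n) w > 1 - r / n.+1%:R]).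
  by apply: fine_le; rewrite ?fin_num_measure ?cdf_le// lateE.
move: h1 h2 l1 l2; rewrite !ltr_norml => /andP[? ?] /andP[? ?] ? ?.
by apply/andP; split; lra.
Unshelve. all: by end_near. Qed.
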